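(* Let $\mathcal{E}=(\mathbb{E},\mathtt{A},\bigotimes,I,u_l,u_r,aso)$ be a liberal monoidal overcategory over a category $\mathbb{G}$ such that for every object $B$ of $\mathbb{G}$ the object $I(B)$ is initial in the fibre $\mathbb{E}_B$, and for every morphism $b$ of $\mathbb{G}$ the object $I(b)$ is initial in the fibre $\mathbb{E}_b$. Then the forgetful overfunctor $$U:(/\mathbb{M}\mathrm{on}(\mathbb{E},\mathtt{A}),\mathtt{A})\longrightarrow(\mathbb{E},\mathtt{A}),\qquad (C,m,e;C_0)\mapsto C,$$ has a left overadjoint $M\dashv U$, and $U$ is overmonadic.
   Context: An overcategory over $\mathbb{G}$ is a pair $(\mathbb{E},\mathtt{A})$ with $\mathtt{A}:\mathbb{E}\to\mathbb{G}$ a functor; an overfunctor is a functor commuting with the functors to $\mathbb{G}$. $\mathrm{CAT}/\mathbb{G}$ is the 2-category of overcategories, overfunctors, and natural transformations $\tau$ such that every $\mathtt{A}(\tau_x)$ is an identity. A left overadjoint is a left adjoint in this 2-category. An overfunctor $U$ with left overadjoint is overmonadic if the comparison overfunctor to the Eilenberg–Moore category of the induced monad (with arity functor $(x,h)\mapsto \mathtt{A}(x)$) is an isomorphism in $\mathrm{CAT}/\mathbb{G}$. Fibres: for an object $B$ of $\mathbb{G}$, $\mathbb{E}_B$ is the subcategory of $\mathbb{E}$ of objects $X$ with $\mathtt{A}(X)=B$ and morphisms $f$ with $\mathtt{A}(f)=1_B$. For a morphism $b:B\to B'$ of $\mathbb{G}$, $\mathbb{E}_b$ is the category whose objects are the morphisms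 $f:X\to X'$ of $\mathbb{E}$ with $\mathtt{A}(f)=b$, and whose morphisms from $f:X\to X'$ to $g:Y\to Y'$ are pairs $(p:X\to Y,\ p':X'\to Y')$ with $p\in\mathbb{E}_B$, $p'\in\mathbb{E}_{B'}$, $gp=p'f$. A monoidal overcategory over $\mathbb{G}$ is a monoidal object of the 2-category $\mathrm{CAT}/\mathbb{G}$: it consists of an overcategory $(\mathbb{E},\mathtt{A})$, an overfunctor $\bigotimes:\mathbb{E}\times_{\mathbb{G}}\mathbb{E}\to\mathbb{E}$ (with $\mathbb{E}\times_{\mathbb{G}}\mathbb{E}$ the kernel pair of $\mathtt{A}$), a functor $I:\mathbb{G}\to\mathbb{E}$ with $\mathtt{A}I=1_{\mathbb{G}}$, and natural isomorphisms in $\mathrm{CAT}/\mathbb{G}$: $u_r:\bigotimes(1_{\mathbb{E}},I\mathtt{A})\to 1_{\mathbb{E}}$, $u_l:\bigotimes(I\mathtt{A},1_{\mathbb{E}})\to 1_{\mathbb{E}}$, $aso:\bigotimes(\bigotimes\times 1_{\mathbb{E}})\to\bigotimes(1_{\mathbb{E}}\times\bigotimes)$, satisfying the usual coherence axioms of monoidal categories. In particular each fibre $\mathbb{E}_B$ is a monoidal category with unit $I(B)$. Let $\overrightarrow{\mathbb{N}}$ be the category of non-negative integers with the natural order. A monoidal category $\mathbb{V}$ is liberal if: it has $\overrightarrow{\mathbb{N}}$-colimits and coequalizers; for every object $X$ the functors $(-)\otimes X$ and $X\otimes(-)$ preserve $\overrightarrow{\mathbb{N}}$-colimits; and for every $X$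 the functor $(-)\otimes X$ preserves coequalizers. A monoidal overcategory is liberal if for every object $B$ of $\mathbb{G}$ the fibre $\mathbb{E}_B$ is a liberal monoidal category and the inclusion $\mathbb{E}_B\hookrightarrow\mathbb{E}$ preserves coequalizers and $\overrightarrow{\mathbb{N}}$-colimits. An overmonoid in $\mathcal{E}$ is $(C,m,e;C_0)$ with $C_0$ an object of $\mathbb{G}$ and $(C,m,e)$ a monoid in the monoidal category $\mathbb{E}_{C_0}$ (multiplication $m$, unit $e$). A morphism $(C,m,e;C_0)\to(C',m',e';C_0')$ is a pair $(f,f_0)$ with $f_0:C_0\to C_0'$ in $\mathbb{G}$, $f:C\to C'$ in $\mathbb{E}$, $\mathtt{A}(f)=f_0$, $fm=m'(f\otimes f)$, $fe=e'I(f_0)$. The category of overmonoids is denoted $/\mathbb{M}\mathrm{on}(\mathbb{E},\mathtt{A})$; its arity functor sends $(C,m,e;C_0)$ to $C_0$ and $(f,f_0)$ to $f_0$. *)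

(* Defs.v *)
Set Warnings "-notation-overridden".
From mathcomp Require Import ssreflect ssrfun ssrbool eqtype ssrnat.
From Stdlib Require Import StrictProp Classical_Prop.

Set Implicit Arguments.
Unset Strict Implicit.
Unset Printing Implicit Defensive.

Record Category := {
  Ob :> Type;
  Hom : Ob -> Ob -> Type;
  idm : forall x, Hom x x;
  cmp : forall x y z, Hom y z -> Hom x y -> Hom x z;
  cmp_idl : forall x y (f : Hom x y), cmp (idm y) f = f;
  cmp_idr : forall x y (f : Hom x y), cmp f (idm x) = f;
  cmpA : forall x y z w (h : Hom z w) (g : Hom y z) (f : Hom x y),
    cmp h (cmp g f) = cmp (cmp h g) f }.

Arguments Hom {c} x y.
Arguments idm {c} x.
Arguments cmp {c x y z} g f.

Declare Scope cat_scope.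
Delimit Scope cat_scope with cat.
Open Scope cat_scope.

Notation "g ∘ f" := (cmp g f) (at level 40, left associativity) : cat_scope.

Record Functor (C D : Category) := {
  fob :> C -> D;
  fmap : forall x y, Hom x y -> Hom (fob x) (fob y);
  fmap_id : forall x, fmap (idm x) = idm (fob x);
  fmap_cmp : forall x y z (g : Hom y z) (f : Hom x y),
    fmap (g ∘ f) = fmap g ∘ fmap f }.

Arguments fmap {C D} F {x y} f : rename.

Definition functor_id (C : Category) : Functor C C := {|
  fob := fun x => x;
  fmap := fun x y f => f;
  fmap_id := fun x => erefl;
  fmap_cmp := fun x y z g f => erefl |}.

Lemma functor_comp_id (C D E : Category) (F : Functor D E) (H : Functor C D) (x : C) :
  fmap F (fmap H (idm x)) = idm (F (H x)).
Proof. by rewrite !fmap_id. Qed.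

Lemma functor_comp_cmp (C D E : Category) (F : Functor D E) (H : Functor C D)
    (x y z : C) (g : Hom y z) (f : Hom x y) :
  fmap F (fmap H (g ∘ f)) = fmap F (fmap H g) ∘ fmap F (fmap H f).
Proof. by rewrite !fmap_cmp. Qed.

Definition functor_comp (C D E : Category) (F : Functor D E) (H : Functor C D) :
    Functor C E := {|
  fob := fun x => F (H x);
  fmap := fun x y f => fmap F (fmap H f);
  fmap_id := functor_comp_id F H;
  fmap_cmp := functor_comp_cmp F H |}.

Record NatTrans (C D : Category) (F H : Functor C D) := {
  ntc :> forall x : C, Hom (F x) (H x);
  nt_nat : forall (x y : C) (f : Hom x y), fmap H f ∘ ntc x = ntc y ∘ fmap F f }.

Definition is_iso (C : Category) (x y : C) (f : Hom x y) : Prop :=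
  exists g : Hom y x, g ∘ f = idm x /\ f ∘ g = idm y.

Definition is_initial (C : Category) (x : C) : Prop :=
  forall y : C, exists f : Hom x y, forall g : Hom x y, g = f.

Definition prodcat (C D : Category) : Category.
Proof.
exists (C * D)%type (fun x y => (Hom x.1 y.1 * Hom x.2 y.2)%type)
  (fun x => (idm x.1, idm x.2)) (fun x y z g f => (g.1 ∘ f.1, g.2 ∘ f.2)).
- abstract (by move=> x y [f f'] /=; rewrite !cmp_idl).
- abstract (by move=> x y [f f'] /=; rewrite !cmp_idr).
- abstract (by move=> x y z w h g f /=; rewrite !cmpA).
Defined.

(* Equality of arrows whose end points are equal but not convertible. *)
Inductive arr_eq (C : Category) (x y : C) (f : Hom x y) :
  forall x' y' : C, Hom x' y' -> Prop :=
| arr_eq_refl : arr_eq f f.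

Arguments arr_eq {C x y} f {x' y'} f'.
Arguments arr_eq_refl {C x y f}.

Notation "f ≈ g" := (arr_eq f g) (at level 70) : cat_scope.

Definition is_identity (C : Category) (x y : C) (f : Hom x y) : Prop := f ≈ idm x.

Definition functor_eq (C D : Category) (F H : Functor C D) : Prop :=
  (forall x, F x = H x) /\ (forall x y (f : Hom x y), fmap F f ≈ fmap H f).

(* The identity arrow, seen as an arrow between two equal objects. *)
Definition eqm (C : Category) (x y : C) (e : x = y) : Hom x y :=
  match e in _ = z return Hom x z with erefl => idm x end.

Section ArrEq.
Variable C : Category.

Lemma arr_eq_sym (x y x' y' : C) (f : Hom x y) (f' : Hom x' y') :
  f ≈ f' -> f' ≈ f.
Proof. by move=> h; case: h; exact: arr_eq_refl. Qed.

Lemma arr_eq_trans (x y x' y' x'' y'' : C)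
    (f : Hom x y) (f' : Hom x' y') (f'' : Hom x'' y'') :
  f ≈ f' -> f' ≈ f'' -> f ≈ f''.
Proof. by move=> h; case: h. Qed.

Lemma arr_eq_src (x y x' y' : C) (f : Hom x y) (f' : Hom x' y') :
  f ≈ f' -> x = x'.
Proof. by move=> h; case: h. Qed.

Lemma arr_eq_tgt (x y x' y' : C) (f : Hom x y) (f' : Hom x' y') :
  f ≈ f' -> y = y'.
Proof. by move=> h; case: h. Qed.

Lemma arr_eqP (x y : C) (f f' : Hom x y) : f ≈ f' -> f = f'.
Proof.
have gen (x' y' : C) (g : Hom x' y') (ex : x' = x) (ey : y' = y) :
  f ≈ g -> eqm ey ∘ g = f ∘ eqm ex.
- move=> h; case: h ex ey => ex ey.
  rewrite (proof_irrelevance _ ex erefl) (proof_irrelevance _ ey erefl) /=.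
  by rewrite cmp_idl cmp_idr.
by move=> /(gen _ _ _ erefl erefl); rewrite /= cmp_idl cmp_idr.
Qed.

Lemma arr_eq_cmp (x y z x' y' z' : C) (g : Hom y z) (f : Hom x y)
    (g' : Hom y' z') (f' : Hom x' y') :
  g ≈ g' -> f ≈ f' -> g ∘ f ≈ g' ∘ f'.
Proof.
move=> hg hf.
have ex := arr_eq_src hf; have ey := arr_eq_src hg; have ez := arr_eq_tgt hg.
subst; rewrite (arr_eqP hg) (arr_eqP hf); exact: arr_eq_refl.
Qed.

Lemma eq_idm (x y : C) : x = y -> idm x ≈ idm y.
Proof. by move=> ->; exact: arr_eq_refl. Qed.

Lemma eqm_idm (x y : C) (e : x = y) : eqm e ≈ idm x.
Proof. by case: y / e. Qed.

Lemma arr_eq_idl (x y z : C) (g : Hom y z) (f : Hom x y) :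
  is_identity g -> g ∘ f ≈ f.
Proof.
move=> hg; have ez := arr_eq_tgt hg; subst.
by rewrite (arr_eqP hg) cmp_idl; exact: arr_eq_refl.
Qed.

Lemma is_identity_inv (x y : C) (f : Hom x y) (g : Hom y x) :
  is_identity f -> g ∘ f = idm x -> is_identity g.
Proof.
move=> hf e; have ey := arr_eq_tgt hf; subst.
by move: e; rewrite (arr_eqP hf) cmp_idr => ->; exact: arr_eq_refl.
Qed.

End ArrEq.

Lemma arr_eq_fmap (C D : Category) (F : Functor C D) (x y x' y' : C)
    (f : Hom x y) (f' : Hom x' y') :
  f ≈ f' -> fmap F f ≈ fmap F f'.
Proof. by case; exact: arr_eq_refl. Qed.

Lemma is_identity_fmap (C D : Category) (F : Functor C D) (x y : C) (f : Hom x y) :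
  is_identity f -> is_identity (fmap F f).
Proof. by move=> /(arr_eq_fmap F); rewrite fmap_id. Qed.

Lemma functor_eq_refl (C D : Category) (F : Functor C D) : functor_eq F F.
Proof. by []. Qed.

(* Over-conditions in pullbacks and fibres are stored squashed into [SProp],
   so that objects and arrows there are determined, up to conversion, by their
   underlying data.  Classically nothing is lost, by [unsquash]. *)
Lemma unsquash (P : Prop) : Squash P -> P.
Proof.
move=> s; case: (classic P) => // nP.
apply: sEmpty_ind; refine (Squash_sind _ (fun _ => sEmpty) _ s) => p.
by case: (nP p).
Qed.

Record OverCat (G : Category) := {
  otot :> Category;
  ar : Functor otot G }.

Arguments ar {G} E : rename.

Record OverFunctor (G : Category) (E F : OverCat G) := {
  ofun :> Functor E F;
  ofun_ar : functor_eq (functor_comp (ar F) ofun) (ar E) }.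

Record OverNat (G : Category) (E F : OverCat G) (H K : OverFunctor E F) := {
  onat :> NatTrans H K;
  onat_ar : forall x : E, is_identity (fmap (ar F) (onat x)) }.

Record OverNatIso (G : Category) (E F : OverCat G) (H K : OverFunctor E F) := {
  oiso :> OverNat H K;
  oiso_iso : forall x : E, is_iso (oiso x) }.

Section OverCategories.
Variable G : Category.

Lemma ofun_arE (E F : OverCat G) (H : OverFunctor E F) (x : E) :
  ar F (H x) = ar E x.
Proof. exact: (proj1 (ofun_ar H)). Qed.

Lemma ofun_arM (E F : OverCat G) (H : OverFunctor E F) (x y : E) (f : Hom x y) :
  fmap (ar F) (fmap H f) ≈ fmap (ar E) f.
Proof. exact: (proj2 (ofun_ar H)). Qed.

Definition over_base : OverCat G := {| otot := G; ar := functor_id G |}.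

Lemma over_comp_ar (D E F : OverCat G) (H : OverFunctor E F) (K : OverFunctor D E) :
  functor_eq (functor_comp (ar F) (functor_comp H K)) (ar D).
Proof.
split=> [x|x y f] /=; first by rewrite !ofun_arE.
exact: arr_eq_trans (ofun_arM _ _) (ofun_arM _ _).
Qed.

Definition over_id (E : OverCat G) : OverFunctor E E :=
  {| ofun := functor_id E; ofun_ar := functor_eq_refl (ar E) |}.

Definition over_comp (D E F : OverCat G) (H : OverFunctor E F)
    (K : OverFunctor D E) : OverFunctor D F :=
  {| ofun := functor_comp H K; ofun_ar := over_comp_ar H K |}.

(* [E × F] over [G]; for [E = F] this is the kernel pair of [ar E]. *)
Set Primitive Projections.
Record pb_ob (E F : OverCat G) := PbOb {
  pb1 : E;
  pb2 : F;
  pb_eq : Squash (ar E pb1 = ar F pb2) }.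

Record pb_hom (E F : OverCat G) (p q : pb_ob E F) := PbHom {
  pbm1 : Hom (pb1 p) (pb1 q);
  pbm2 : Hom (pb2 p) (pb2 q);
  pbm_eq : Squash (fmap (ar E) pbm1 ≈ fmap (ar F) pbm2) }.
Unset Primitive Projections.

Lemma pb_hom_eq (E F : OverCat G) (p q : pb_ob E F) (f g : pb_hom p q) :
  pbm1 f = pbm1 g -> pbm2 f = pbm2 g -> f = g.
Proof. by case: f => f1 f2 f3; case: g => g1 g2 g3 /= e1 e2; subst g1 g2. Qed.

Lemma pb_id_eq (E F : OverCat G) (p : pb_ob E F) :
  Squash (fmap (ar E) (idm (pb1 p)) ≈ fmap (ar F) (idm (pb2 p))).
Proof.
by apply: squash; rewrite !fmap_id; exact: eq_idm (unsquash (pb_eq p)).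
Qed.

Lemma pb_cmp_eq (E F : OverCat G) (p q r : pb_ob E F) (g : pb_hom q r) (f : pb_hom p q) :
  Squash (fmap (ar E) (pbm1 g ∘ pbm1 f) ≈ fmap (ar F) (pbm2 g ∘ pbm2 f)).
Proof.
apply: squash; rewrite !fmap_cmp.
exact: arr_eq_cmp (unsquash (pbm_eq g)) (unsquash (pbm_eq f)).
Qed.

Definition pb_cat (E F : OverCat G) : Category.
Proof.
exists (pb_ob E F) (@pb_hom E F) (fun p => PbHom (pb_id_eq p))
  (fun p q r g f => PbHom (pb_cmp_eq g f)).
- abstract (by move=> p q f; apply: pb_hom_eq; rewrite /= cmp_idl).
- abstract (by move=> p q f; apply: pb_hom_eq; rewrite /= cmp_idr).
- abstract (by move=> p q r s h g f; apply: pb_hom_eq; rewrite /= cmpA).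
Defined.

Definition pb_proj1 (E F : OverCat G) : Functor (pb_cat E F) E.
Proof. by exists (@pb1 E F : pb_cat E F -> E) (@pbm1 E F). Defined.

Definition pb_proj2 (E F : OverCat G) : Functor (pb_cat E F) F.
Proof. by exists (@pb2 E F : pb_cat E F -> F) (@pbm2 E F). Defined.

Definition over_pb (E F : OverCat G) : OverCat G :=
  {| otot := pb_cat E F; ar := functor_comp (ar E) (pb_proj1 E F) |}.

Lemma over_pr2_ar (E F : OverCat G) :
  functor_eq (functor_comp (ar F) (pb_proj2 E F)) (ar (over_pb E F)).
Proof.
split=> [p|p q f] /=; first by rewrite (unsquash (pb_eq p)).
exact: arr_eq_sym (unsquash (pbm_eq f)).
Qed.

Definition over_pr1 (E F : OverCat G) : OverFunctor (over_pb E F) E :=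
  @Build_OverFunctor _ (over_pb E F) E (pb_proj1 E F) (functor_eq_refl _).

Definition over_pr2 (E F : OverCat G) : OverFunctor (over_pb E F) F :=
  @Build_OverFunctor _ (over_pb E F) F (pb_proj2 E F) (over_pr2_ar E F).

Section Pairing.
Variables (D E F : OverCat G) (H : OverFunctor D E) (K : OverFunctor D F).

Lemma pair_eq (x : D) : Squash (ar E (H x) = ar F (K x)).
Proof. by apply: squash; rewrite !ofun_arE. Qed.

Lemma pairm_eq (x y : D) (f : Hom x y) :
  Squash (fmap (ar E) (fmap H f) ≈ fmap (ar F) (fmap K f)).
Proof.
apply: squash; exact: arr_eq_trans (ofun_arM _ _) (arr_eq_sym (ofun_arM _ _)).
Qed.

Definition pair_functor : Functor D (pb_cat E F).
Proof.
exists (fun x => PbOb (pair_eq x) : pb_cat E F)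
  (fun x y f => @PbHom _ _ (PbOb (pair_eq x)) (PbOb (pair_eq y)) _ _ (pairm_eq f)).
- abstract (by move=> x; apply: pb_hom_eq; rewrite /= fmap_id).
- abstract (by move=> x y z g f; apply: pb_hom_eq; rewrite /= fmap_cmp).
Defined.

Lemma over_pair_ar : functor_eq (functor_comp (ar (over_pb E F)) pair_functor) (ar D).
Proof. split; [exact: ofun_arE | exact: ofun_arM]. Qed.

Definition over_pair : OverFunctor D (over_pb E F) :=
  @Build_OverFunctor _ D (over_pb E F) pair_functor over_pair_ar.

End Pairing.

Definition over_ar (E : OverCat G) : OverFunctor E over_base :=
  @Build_OverFunctor _ E over_base (ar E) (functor_eq_refl (ar E)).

Definition is_over_iso (E F : OverCat G) (H : OverFunctor E F) : Prop :=
  exists K : OverFunctor F E,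
    functor_eq (over_comp K H) (over_id E) /\ functor_eq (over_comp H K) (over_id F).

Record LeftOveradjoint (D E : OverCat G) (U : OverFunctor D E) := {
  ladj :> OverFunctor E D;
  adj_unit : OverNat (over_id E) (over_comp U ladj);
  adj_counit : OverNat (over_comp ladj U) (over_id D);
  adj_tri1 : forall x : E,
    adj_counit (ladj x) ∘ fmap ladj (adj_unit x) = idm (ladj x);
  adj_tri2 : forall y : D,
    fmap U (adj_counit y) ∘ adj_unit (U y) = idm (U y) }.

Record OverMonad (E : OverCat G) := {
  mon_fun :> OverFunctor E E;
  mon_unit : OverNat (over_id E) mon_fun;
  mon_mul : OverNat (over_comp mon_fun mon_fun) mon_fun;
  mon_unitl : forall x : E, mon_mul x ∘ mon_unit (mon_fun x) = idm (mon_fun x);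
  mon_unitr : forall x : E, mon_mul x ∘ fmap mon_fun (mon_unit x) = idm (mon_fun x);
  mon_assoc : forall x : E,
    mon_mul x ∘ mon_mul (mon_fun x) = mon_mul x ∘ fmap mon_fun (mon_mul x) }.

Section InducedMonad.
Variables (D E : OverCat G) (U : OverFunctor D E) (L : LeftOveradjoint U).

Definition induced_mul :
  OverNat (over_comp (over_comp U L) (over_comp U L)) (over_comp U L).
Proof.
unshelve eexists.
- exists (fun x : E => fmap U (adj_counit L (L x))).
  abstract (move=> x y f /=; rewrite -!fmap_cmp; congr (fmap U _);
    exact: (nt_nat (adj_counit L) (fmap L f))).
- abstract (move=> x /=; apply: arr_eq_trans (ofun_arM U _) _;
    apply: arr_eq_trans (onat_ar (adj_counit L) _) _;
    by apply: eq_idm; exact: esym (ofun_arE U _)).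
Defined.

Definition induced_monad : OverMonad E.
Proof.
exists (over_comp U L) (adj_unit L) induced_mul.
- abstract (by move=> x /=; exact: adj_tri2).
- abstract (by move=> x /=; rewrite -fmap_cmp adj_tri1 fmap_id).
- abstract (move=> x /=; rewrite -!fmap_cmp; congr (fmap U _);
    exact: (nt_nat (adj_counit L) (adj_counit L (L x)))).
Defined.

End InducedMonad.

Section EilenbergMoore.
Variables (E : OverCat G) (T : OverMonad E).

Record em_ob := EmOb {
  em_car : E;
  em_act : Hom (T em_car) em_car;
  em_unit : em_act ∘ mon_unit T em_car = idm em_car;
  em_mul : em_act ∘ fmap T em_act = em_act ∘ mon_mul T em_car }.

Record em_hom (x y : em_ob) := EmHom {
  em_arr : Hom (em_car x) (em_car y);
  em_arr_act : em_arr ∘ em_act x = em_act y ∘ fmap T em_arr }.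

Lemma em_hom_eq (x y : em_ob) (f g : em_hom x y) : em_arr f = em_arr g -> f = g.
Proof.
case: f => f hf; case: g => g hg /= e; subst g.
by rewrite (proof_irrelevance _ hf hg).
Qed.

Lemma em_id_act (x : em_ob) :
  idm (em_car x) ∘ em_act x = em_act x ∘ fmap T (idm (em_car x)).
Proof. by rewrite fmap_id cmp_idl cmp_idr. Qed.

Lemma em_cmp_act (x y z : em_ob) (g : em_hom y z) (f : em_hom x y) :
  em_arr g ∘ em_arr f ∘ em_act x = em_act z ∘ fmap T (em_arr g ∘ em_arr f).
Proof. by rewrite fmap_cmp -cmpA em_arr_act cmpA em_arr_act cmpA. Qed.

Definition em_cat : Category.
Proof.
exists em_ob em_hom (fun x => EmHom (em_id_act x))
  (fun x y z g f => EmHom (em_cmp_act g f)).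
- abstract (by move=> x y f; apply: em_hom_eq; rewrite /= cmp_idl).
- abstract (by move=> x y f; apply: em_hom_eq; rewrite /= cmp_idr).
- abstract (by move=> x y z w h g f; apply: em_hom_eq; rewrite /= cmpA).
Defined.

Definition em_forget : Functor em_cat E.
Proof. by exists (em_car : em_cat -> E) em_arr. Defined.

Definition over_em : OverCat G :=
  {| otot := em_cat; ar := functor_comp (ar E) em_forget |}.

End EilenbergMoore.

Section Comparison.
Variables (D E : OverCat G) (U : OverFunctor D E) (L : LeftOveradjoint U).

Lemma comparison_mul (y : D) :
  fmap U (adj_counit L y) ∘ fmap (induced_monad L) (fmap U (adj_counit L y)) =
  fmap U (adj_counit L y) ∘ mon_mul (induced_monad L) (U y).
Proof.
rewrite /= -!fmap_cmp; congr (fmap U _).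
exact: esym (nt_nat (adj_counit L) (adj_counit L y)).
Qed.

Lemma comparison_act (x y : D) (f : Hom x y) :
  fmap U f ∘ fmap U (adj_counit L x) =
  fmap U (adj_counit L y) ∘ fmap (induced_monad L) (fmap U f).
Proof.
rewrite /= -!fmap_cmp; congr (fmap U _).
exact: (nt_nat (adj_counit L) f).
Qed.

Definition comparison_ob (y : D) : em_cat (induced_monad L) :=
  @EmOb _ (induced_monad L) (U y) (fmap U (adj_counit L y)) (adj_tri2 L y)
    (comparison_mul y).

Definition comparison_functor : Functor D (em_cat (induced_monad L)).
Proof.
exists comparison_ob (fun x y f =>
  @EmHom _ _ (comparison_ob x) (comparison_ob y) (fmap U f) (comparison_act f)).
- abstract (by move=> x; apply: em_hom_eq; rewrite /= fmap_id).
- abstract (by move=> x y z g f; apply: em_hom_eq; rewrite /= fmap_cmp).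
Defined.

Definition comparison : OverFunctor D (over_em (induced_monad L)) :=
  @Build_OverFunctor _ D (over_em (induced_monad L)) comparison_functor (ofun_ar U).

Definition overmonadic : Prop := is_over_iso comparison.

End Comparison.

Section Fibres.
Variable E : OverCat G.

Set Primitive Projections.
Record fibre_ob (B : G) := FibreOb {
  fo :> E;
  fo_over : Squash (ar E fo = B) }.

Record fibre_hom (B : G) (x y : fibre_ob B) := FibreHom {
  fh : Hom (fo x) (fo y);
  fh_over : Squash (fmap (ar E) fh ≈ idm B) }.
Unset Primitive Projections.

Lemma fibre_hom_eq (B : G) (x y : fibre_ob B) (f g : fibre_hom x y) :
  fh f = fh g -> f = g.
Proof. by case: f => f hf; case: g => g hg /= e; subst g. Qed.

Lemma fibre_id_over (B : G) (x : fibre_ob B) :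
  Squash (fmap (ar E) (idm (fo x)) ≈ idm B).
Proof.
by apply: squash; rewrite fmap_id; exact: eq_idm (unsquash (fo_over x)).
Qed.

Lemma fibre_cmp_over (B : G) (x y z : fibre_ob B) (g : fibre_hom y z) (f : fibre_hom x y) :
  Squash (fmap (ar E) (fh g ∘ fh f) ≈ idm B).
Proof.
apply: squash; rewrite fmap_cmp -(cmp_idl (idm B)).
exact: arr_eq_cmp (unsquash (fh_over g)) (unsquash (fh_over f)).
Qed.

Definition fibre (B : G) : Category.
Proof.
exists (fibre_ob B) (@fibre_hom B) (fun x => FibreHom (fibre_id_over x))
  (fun x y z g f => FibreHom (fibre_cmp_over g f)).
- abstract (by move=> x y f; apply: fibre_hom_eq; rewrite /= cmp_idl).
- abstract (by move=> x y f; apply: fibre_hom_eq; rewrite /= cmp_idr).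
- abstract (by move=> x y z w h g f; apply: fibre_hom_eq; rewrite /= cmpA).
Defined.

Definition fibre_incl (B : G) : Functor (fibre B) E.
Proof. by exists (@fo B : fibre B -> E) (@fh B). Defined.

Section ArrowFibre.
Variables (B B' : G) (b : Hom B B').

(* The end points of an arrow over [b] lie in the fibres over [B] and [B'];
   they are recorded as objects of those fibres. *)
Record afibre_ob := AFibreOb {
  af_src : fibre B;
  af_tgt : fibre B';
  af_arr : Hom (fo af_src) (fo af_tgt);
  af_over : Squash (fmap (ar E) af_arr ≈ b) }.

Record afibre_hom (f g : afibre_ob) := AFibreHom {
  af_hsrc : Hom (af_src f) (af_src g);
  af_htgt : Hom (af_tgt f) (af_tgt g);
  af_comm : af_arr g ∘ fh af_hsrc = fh af_htgt ∘ af_arr f }.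

Lemma afibre_hom_eq (f g : afibre_ob) (p q : afibre_hom f g) :
  af_hsrc p = af_hsrc q -> af_htgt p = af_htgt q -> p = q.
Proof.
case: p => p p' hp; case: q => q q' hq /= e e'; subst q q'.
by rewrite (proof_irrelevance _ hp hq).
Qed.

Lemma afibre_id_comm (f : afibre_ob) :
  af_arr f ∘ fh (idm (af_src f)) = fh (idm (af_tgt f)) ∘ af_arr f.
Proof. by rewrite /= cmp_idl cmp_idr. Qed.

Lemma afibre_cmp_comm (f g h : afibre_ob) (q : afibre_hom g h) (p : afibre_hom f g) :
  af_arr h ∘ fh (af_hsrc q ∘ af_hsrc p) = fh (af_htgt q ∘ af_htgt p) ∘ af_arr f.
Proof. by rewrite /= cmpA af_comm -cmpA af_comm cmpA. Qed.

Definition afibre : Category.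
Proof.
exists afibre_ob afibre_hom (fun f => AFibreHom (afibre_id_comm f))
  (fun f g h q p => AFibreHom (afibre_cmp_comm q p)).
- abstract (by move=> f g p; apply: afibre_hom_eq; exact: cmp_idl).
- abstract (by move=> f g p; apply: afibre_hom_eq; exact: cmp_idr).
- abstract (by move=> f g h k r q p; apply: afibre_hom_eq; exact: cmpA).
Defined.

End ArrowFibre.

End Fibres.

End OverCategories.

Record Cocone (J C : Category) (D : Functor J C) := {
  apex : C;
  leg : forall j : J, Hom (D j) apex;
  leg_nat : forall (i j : J) (u : Hom i j), leg j ∘ fmap D u = leg i }.

Definition is_colimit (J C : Category) (D : Functor J C) (c : Cocone D) : Prop :=
  forall c' : Cocone D,
    exists! h : Hom (apex c) (apex c'), forall j, h ∘ leg c j = leg c' j.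

Definition map_cocone (J C C' : Category) (F : Functor C C') (D : Functor J C)
  (c : Cocone D) : Cocone (functor_comp F D).
Proof.
exists (F (apex c)) (fun j => fmap F (leg c j)) => i j u /=.
by rewrite -fmap_cmp leg_nat.
Defined.

Definition has_colimits (J C : Category) : Prop :=
  forall D : Functor J C, exists c : Cocone D, is_colimit c.

Definition preserves_colimits (J C C' : Category) (F : Functor C C') : Prop :=
  forall (D : Functor J C) (c : Cocone D), is_colimit c -> is_colimit (map_cocone F c).

Definition omega : Category.
Proof.
exists nat (fun m n : nat => m <= n)%N leqnn (fun m n p h g => leq_trans g h).
all: by move=> *; exact: bool_irrelevance.
Defined.

Definition is_coequalizer (C : Category) (x y z : C) (f g : Hom x y) (q : Hom y z) : Prop :=
  q ∘ f = q ∘ g /\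
  forall (w : C) (k : Hom y w), k ∘ f = k ∘ g -> exists! h : Hom z w, h ∘ q = k.

Definition has_coequalizers (C : Category) : Prop :=
  forall (x y : C) (f g : Hom x y), exists (z : C) (q : Hom y z), is_coequalizer f g q.

Definition preserves_coequalizers (C C' : Category) (F : Functor C C') : Prop :=
  forall (x y z : C) (f g : Hom x y) (q : Hom y z),
    is_coequalizer f g q -> is_coequalizer (fmap F f) (fmap F g) (fmap F q).

Record MonoidalCat := {
  mcat :> Category;
  mtens : Functor (prodcat mcat mcat) mcat;
  munit : mcat;
  mlu : forall X : mcat, Hom (mtens (munit, X)) X;
  mru : forall X : mcat, Hom (mtens (X, munit)) X;
  mas : forall X Y Z : mcat, Hom (mtens (mtens (X, Y), Z)) (mtens (X, mtens (Y, Z)));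
  mlu_nat : forall (X X' : mcat) (f : Hom X X'),
    f ∘ mlu X = mlu X' ∘ @fmap _ _ mtens (munit, X) (munit, X') (idm munit, f);
  mru_nat : forall (X X' : mcat) (f : Hom X X'),
    f ∘ mru X = mru X' ∘ @fmap _ _ mtens (X, munit) (X', munit) (f, idm munit);
  mas_nat : forall (X X' Y Y' Z Z' : mcat)
      (f : Hom X X') (g : Hom Y Y') (h : Hom Z Z'),
    @fmap _ _ mtens (X, mtens (Y, Z)) (X', mtens (Y', Z'))
      (f, @fmap _ _ mtens (Y, Z) (Y', Z') (g, h)) ∘ mas X Y Z =
    mas X' Y' Z' ∘ @fmap _ _ mtens (mtens (X, Y), Z) (mtens (X', Y'), Z')
      (@fmap _ _ mtens (X, Y) (X', Y') (f, g), h);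
  mlu_iso : forall X, is_iso (mlu X);
  mru_iso : forall X, is_iso (mru X);
  mas_iso : forall X Y Z, is_iso (mas X Y Z);
  mpentagon : forall W X Y Z : mcat,
    @fmap _ _ mtens (W, mtens (mtens (X, Y), Z)) (W, mtens (X, mtens (Y, Z)))
      (idm W, mas X Y Z) ∘ mas W (mtens (X, Y)) Z ∘
      @fmap _ _ mtens (mtens (mtens (W, X), Y), Z) (mtens (W, mtens (X, Y)), Z)
        (mas W X Y, idm Z) =
    mas W X (mtens (Y, Z)) ∘ mas (mtens (W, X)) Y Z;
  mtriangle : forall X Y : mcat,
    @fmap _ _ mtens (X, mtens (munit, Y)) (X, Y) (idm X, mlu Y) ∘ mas X munit Y =
    @fmap _ _ mtens (mtens (X, munit), Y) (X, Y) (mru X, idm Y) }.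

Section MonoidalCategories.
Variable V : MonoidalCat.

Definition mtm (X X' Y Y' : V) (f : Hom X X') (g : Hom Y Y') :
  Hom (mtens V (X, Y)) (mtens V (X', Y')) :=
  @fmap _ _ (mtens V) (X, Y) (X', Y') (f, g).

Definition tensor_right (X : V) : Functor V V.
Proof.
exists (fun Y => mtens V (Y, X)) (fun Y Y' f => mtm f (idm X)).
- by move=> Y; exact: fmap_id.
- move=> Y Y' Y'' g f; rewrite -[in LHS](cmp_idl (idm X)).
  exact: (@fmap_cmp _ _ (mtens V) (Y, X) (Y', X) (Y'', X) (g, idm X) (f, idm X)).
Defined.

Definition tensor_left (X : V) : Functor V V.
Proof.
exists (fun Y => mtens V (X, Y)) (fun Y Y' f => mtm (idm X) f).
- by move=> Y; exact: fmap_id.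
- move=> Y Y' Y'' g f; rewrite -[in LHS](cmp_idl (idm X)).
  exact: (@fmap_cmp _ _ (mtens V) (X, Y) (X, Y') (X, Y'') (idm X, g) (idm X, f)).
Defined.

Definition liberal : Prop :=
  [/\ has_colimits omega V /\ has_coequalizers V,
      forall X, preserves_colimits omega (tensor_right X),
      forall X, preserves_colimits omega (tensor_left X) &
      forall X, preserves_coequalizers (tensor_right X)].

Record Monoid := {
  mo_car :> V;
  mo_mul : Hom (mtens V (mo_car, mo_car)) mo_car;
  mo_one : Hom (munit V) mo_car;
  mo_assoc : mo_mul ∘ mtm mo_mul (idm mo_car) =
    mo_mul ∘ mtm (idm mo_car) mo_mul ∘ mas mo_car mo_car mo_car;
  mo_unitl : mo_mul ∘ mtm mo_one (idm mo_car) = mlu mo_car;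
  mo_unitr : mo_mul ∘ mtm (idm mo_car) mo_one = mru mo_car }.

End MonoidalCategories.

Record MonoidalOverData (G : Category) := {
  mtot :> OverCat G;
  otens : OverFunctor (over_pb mtot mtot) mtot;
  ounit : OverFunctor (over_base G) mtot;
  our : OverNatIso
    (over_comp otens (over_pair (over_id mtot) (over_comp ounit (over_ar mtot))))
    (over_id mtot);
  oul : OverNatIso
    (over_comp otens (over_pair (over_comp ounit (over_ar mtot)) (over_id mtot)))
    (over_id mtot);
  oas : OverNatIso
    (over_comp otens
      (over_pair (over_comp otens (over_pr1 (over_pb mtot mtot) mtot))
                 (over_pr2 (over_pb mtot mtot) mtot)))
    (over_comp otens
      (over_pair
        (over_comp (over_pr1 mtot mtot) (over_pr1 (over_pb mtot mtot) mtot))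
        (over_comp otens
          (over_pair
            (over_comp (over_pr2 mtot mtot) (over_pr1 (over_pb mtot mtot) mtot))
            (over_pr2 (over_pb mtot mtot) mtot))))) }.

Section MonoidalOver.
Variables (G : Category) (E : MonoidalOverData G).

Definition tens (X Y : E) (h : Squash (ar E X = ar E Y)) : E :=
  otens E (PbOb h).

Definition tensm (X X' Y Y' : E) (h : Squash (ar E X = ar E Y))
    (h' : Squash (ar E X' = ar E Y')) (f : Hom X X') (g : Hom Y Y')
    (hfg : Squash (fmap (ar E) f ≈ fmap (ar E) g)) : Hom (tens h) (tens h') :=
  @fmap _ _ (otens E) (PbOb h) (PbOb h') (@PbHom _ _ _ (PbOb h) (PbOb h') f g hfg).

Lemma tens_ar (X Y : E) (h : Squash (ar E X = ar E Y)) : ar E (tens h) = ar E X.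
Proof. exact: (ofun_arE (otens E) (PbOb h)). Qed.

Lemma tensm_ar (X X' Y Y' : E) (h : Squash (ar E X = ar E Y))
    (h' : Squash (ar E X' = ar E Y')) (f : Hom X X') (g : Hom Y Y')
    (hfg : Squash (fmap (ar E) f ≈ fmap (ar E) g)) :
  fmap (ar E) (tensm h h' hfg) ≈ fmap (ar E) f.
Proof.
exact: (ofun_arM (otens E) (@PbHom _ _ _ (PbOb h) (PbOb h') f g hfg)).
Qed.

Variable B : G.

Lemma fibre_eq (X Y : fibre E B) : Squash (ar E (fo X) = ar E (fo Y)).
Proof.
by apply: squash; rewrite (unsquash (fo_over X)) (unsquash (fo_over Y)).
Qed.

Lemma fibre_hom_sq (X X' Y Y' : fibre E B) (f : Hom X X') (g : Hom Y Y') :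
  Squash (fmap (ar E) (fh f) ≈ fmap (ar E) (fh g)).
Proof.
have hf := unsquash (fh_over f); have hg := unsquash (fh_over g); apply: squash.
exact: arr_eq_trans hf (arr_eq_sym hg).
Qed.

Lemma squash_over_id (X Y : fibre E B) (f : Hom (fo X) (fo Y)) :
  is_identity (fmap (ar E) f) -> Squash (fmap (ar E) f ≈ idm B).
Proof.
move=> hf; have hX := unsquash (fo_over X); apply: squash.
exact: arr_eq_trans hf (eq_idm hX).
Qed.

Lemma tens_over (X Y : fibre E B) : Squash (ar E (tens (fibre_eq X Y)) = B).
Proof.
by apply: squash; rewrite tens_ar (unsquash (fo_over X)).
Qed.

Definition ftens_ob (X Y : fibre E B) : fibre E B := FibreOb (tens_over X Y).

Lemma tensm_over (X X' Y Y' : fibre E B) (f : Hom X X') (g : Hom Y Y') :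
  Squash (fmap (ar E) (tensm (fibre_eq X Y) (fibre_eq X' Y') (fibre_hom_sq f g))
    ≈ idm B).
Proof.
apply: squash; exact: arr_eq_trans (tensm_ar _ _ _) (unsquash (fh_over f)).
Qed.

Definition ftens_hom (X X' Y Y' : fibre E B) (f : Hom X X') (g : Hom Y Y') :
    Hom (ftens_ob X Y) (ftens_ob X' Y') :=
  @FibreHom _ _ _ (ftens_ob X Y) (ftens_ob X' Y') _ (tensm_over f g).

Lemma ftens_id (p : prodcat (fibre E B) (fibre E B)) :
  ftens_hom (idm p.1) (idm p.2) = idm (ftens_ob p.1 p.2).
Proof.
by apply: fibre_hom_eq; exact: (fmap_id (otens E) (PbOb (fibre_eq p.1 p.2))).
Qed.

Lemma ftens_cmp (X X' X'' Y Y' Y'' : fibre E B) (f' : Hom X' X'') (f : Hom X X')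
    (g' : Hom Y' Y'') (g : Hom Y Y') :
  ftens_hom (f' ∘ f) (g' ∘ g) = ftens_hom f' g' ∘ ftens_hom f g.
Proof. by apply: fibre_hom_eq; rewrite /= /tensm -fmap_cmp. Qed.

Definition ftens : Functor (prodcat (fibre E B) (fibre E B)) (fibre E B) := {|
  fob := fun p : prodcat (fibre E B) (fibre E B) => ftens_ob p.1 p.2 : fibre E B;
  fmap := fun p q f => ftens_hom f.1 f.2;
  fmap_id := ftens_id;
  fmap_cmp := fun p q r g f => ftens_cmp g.1 f.1 g.2 f.2 |}.

Lemma ounit_over : Squash (ar E (ounit E B) = B).
Proof. by apply: squash; exact: ofun_arE. Qed.

Definition funit : fibre E B := FibreOb ounit_over.

(* [I(B) = I(A(X))], since [A(X) = B]. *)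
Definition unit_at (X : fibre E B) : Hom (ounit E B) (ounit E (ar E (fo X))) :=
  fmap (ounit E) (eqm (esym (unsquash (fo_over X)))).

Lemma unit_at_id (X : fibre E B) : is_identity (unit_at X).
Proof. by apply: is_identity_fmap; exact: eqm_idm. Qed.

Lemma unit_at_over (X : fibre E B) : fmap (ar E) (unit_at X) ≈ idm B.
Proof. exact: arr_eq_trans (ofun_arM (ounit E) _) (eqm_idm _). Qed.

Lemma ounit_eqr (X : E) : Squash (ar E X = ar E (ounit E (ar E X))).
Proof. by apply: squash; rewrite (ofun_arE (ounit E)). Qed.

Lemma ounit_eql (X : E) : Squash (ar E (ounit E (ar E X)) = ar E X).
Proof. by apply: squash; rewrite (ofun_arE (ounit E)). Qed.

Lemma unit_at_sqr (X : fibre E B) :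
  Squash (fmap (ar E) (idm (fo X)) ≈ fmap (ar E) (unit_at X)).
Proof.
apply: squash; apply: arr_eq_trans (arr_eq_sym (unit_at_over X)).
by rewrite fmap_id; apply: eq_idm; exact: unsquash (fo_over X).
Qed.

Lemma unit_at_sql (X : fibre E B) :
  Squash (fmap (ar E) (unit_at X) ≈ fmap (ar E) (idm (fo X))).
Proof. by apply: squash; apply: arr_eq_sym; exact: unsquash (unit_at_sqr X). Qed.

Definition frunit_arr (X : fibre E B) : Hom (tens (fibre_eq X funit)) (fo X) :=
  our E (fo X) ∘ tensm (fibre_eq X funit) (ounit_eqr (fo X)) (unit_at_sqr X).

Definition flunit_arr (X : fibre E B) : Hom (tens (fibre_eq funit X)) (fo X) :=
  oul E (fo X) ∘ tensm (fibre_eq funit X) (ounit_eql (fo X)) (unit_at_sql X).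

Lemma frunit_over (X : fibre E B) : Squash (fmap (ar E) (frunit_arr X) ≈ idm B).
Proof.
apply: squash; rewrite /frunit_arr fmap_cmp.
apply: arr_eq_trans (arr_eq_idl _ (onat_ar (our E) (fo X))) _.
apply: arr_eq_trans (tensm_ar _ _ _) _.
exact: unsquash (fibre_id_over X).
Qed.

Lemma flunit_over (X : fibre E B) : Squash (fmap (ar E) (flunit_arr X) ≈ idm B).
Proof.
apply: squash; rewrite /flunit_arr fmap_cmp.
apply: arr_eq_trans (arr_eq_idl _ (onat_ar (oul E) (fo X))) _.
exact: arr_eq_trans (tensm_ar _ _ _) (unit_at_over X).
Qed.

Definition frunit (X : fibre E B) : Hom (ftens_ob X funit) X :=
  @FibreHom _ _ _ (ftens_ob X funit) X _ (frunit_over X).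

Definition flunit (X : fibre E B) : Hom (ftens_ob funit X) X :=
  @FibreHom _ _ _ (ftens_ob funit X) X _ (flunit_over X).

Lemma ftens_eq (X Y Z : fibre E B) :
  Squash (ar (over_pb E E) (PbOb (fibre_eq X Y)) = ar E (fo Z)).
Proof. exact: fibre_eq. Qed.

Definition fassoc_arr (X Y Z : fibre E B) :
    Hom (tens (fibre_eq (ftens_ob X Y) Z)) (tens (fibre_eq X (ftens_ob Y Z))) :=
  oas E (PbOb (ftens_eq X Y Z)).

Lemma fassoc_over (X Y Z : fibre E B) :
  Squash (fmap (ar E) (fassoc_arr X Y Z) ≈ idm B).
Proof.
exact: (@squash_over_id (ftens_ob (ftens_ob X Y) Z) (ftens_ob X (ftens_ob Y Z))
  (fassoc_arr X Y Z) (onat_ar (oas E) (PbOb (ftens_eq X Y Z)))).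
Qed.

Definition fassoc (X Y Z : fibre E B) :
    Hom (ftens_ob (ftens_ob X Y) Z) (ftens_ob X (ftens_ob Y Z)) :=
  @FibreHom _ _ _ (ftens_ob (ftens_ob X Y) Z) (ftens_ob X (ftens_ob Y Z)) _
    (fassoc_over X Y Z).

End MonoidalOver.

(* The coherence diagrams of a monoidal object of CAT/G have components indexed
   by tuples of objects with a common arity, that is, by objects of one fibre. *)
Record MonoidalOverCat (G : Category) := {
  mdata :> MonoidalOverData G;
  opentagon : forall (B : G) (W X Y Z : fibre mdata B),
    ftens_hom (idm W) (fassoc X Y Z) ∘ fassoc W (ftens_ob X Y) Z ∘
      ftens_hom (fassoc W X Y) (idm Z) =
    fassoc W X (ftens_ob Y Z) ∘ fassoc (ftens_ob W X) Y Z;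
  otriangle : forall (B : G) (X Y : fibre mdata B),
    ftens_hom (idm X) (flunit Y) ∘ fassoc X (funit mdata B) Y =
    ftens_hom (frunit X) (idm Y) }.

Section FibreMonoidal.
Variables (G : Category) (E : MonoidalOverCat G).

Lemma iso_cmp (C : Category) (x y z : C) (g : Hom y z) (f : Hom x y) :
  is_iso g -> is_iso f -> is_iso (g ∘ f).
Proof.
case=> g' [g1 g2] [f' [f1 f2]]; exists (f' ∘ g'); split.
- by rewrite -cmpA (cmpA g') g1 cmp_idl.
- by rewrite -cmpA (cmpA f) f2 cmp_idl.
Qed.

Lemma iso_fmap (C D : Category) (F : Functor C D) (x y : C) (f : Hom x y) :
  is_iso f -> is_iso (fmap F f).
Proof.
by case=> g [gf fg]; exists (fmap F g); split; rewrite -fmap_cmp ?gf ?fg fmap_id.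
Qed.

Lemma iso_idm (C : Category) (x : C) : is_iso (idm x).
Proof. by exists (idm x); rewrite cmp_idl. Qed.

Lemma iso_eqm (C : Category) (x y : C) (e : x = y) : is_iso (eqm e).
Proof. by case: y / e; exact: iso_idm. Qed.

Variable B : G.

Lemma fibre_iso (X Y : fibre E B) (f : Hom X Y) : is_iso (fh f) -> is_iso f.
Proof.
case=> g [gf fg].
have hf : is_identity (fmap (ar E) (fh f)).
  apply: arr_eq_trans (unsquash (fh_over f)) (eq_idm _).
  exact: esym (unsquash (fo_over X)).
have hg : fmap (ar E) g ≈ idm B.
  have e : fmap (ar E) g ∘ fmap (ar E) (fh f) = idm _ by rewrite -fmap_cmp gf fmap_id.
  apply: arr_eq_trans (is_identity_inv hf e) (eq_idm _).
  exact: unsquash (fo_over Y).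
exists (@FibreHom _ _ _ Y X g (squash hg)); split; exact: fibre_hom_eq.
Qed.

Lemma tensm_iso (X X' Y Y' : E) (h : Squash (ar E X = ar E Y))
    (h' : Squash (ar E X' = ar E Y')) (f : Hom X X') (g : Hom Y Y')
    (e : Squash (fmap (ar E) f ≈ fmap (ar E) g)) :
  is_identity (fmap (ar E) f) -> is_iso f -> is_iso g -> is_iso (tensm h h' e).
Proof.
move=> hf [f' [f1 f2]] [g' [g1 g2]].
have hg : is_identity (fmap (ar E) g).
  apply: arr_eq_trans (arr_eq_sym (unsquash e)) (arr_eq_trans hf (eq_idm _)).
  exact: unsquash h.
have ef : fmap (ar E) f' ∘ fmap (ar E) f = idm _ by rewrite -fmap_cmp f1 fmap_id.
have eg : fmap (ar E) g' ∘ fmap (ar E) g = idm _ by rewrite -fmap_cmp g1 fmap_id.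
have e' : fmap (ar E) f' ≈ fmap (ar E) g'.
  apply: arr_eq_trans (is_identity_inv hf ef) _.
  apply: arr_eq_trans (eq_idm (unsquash h')) (arr_eq_sym _).
  exact: is_identity_inv hg eg.
exists (tensm h' h (squash e')); rewrite /tensm -!fmap_cmp.
by split; rewrite -[RHS]fmap_id; congr (fmap _ _); apply: pb_hom_eq.
Qed.

Lemma unit_at_nat (X X' : fibre E B) (f : Hom X X') :
  fmap (ounit E) (fmap (ar E) (fh f)) ∘ unit_at X = unit_at X'.
Proof.
rewrite /unit_at -fmap_cmp; congr (fmap _ _); apply: arr_eqP.
have hf : is_identity (fmap (ar E) (fh f)).
  apply: arr_eq_trans (unsquash (fh_over f)) (eq_idm _).
  exact: esym (unsquash (fo_over X)).
apply: arr_eq_trans (arr_eq_idl _ hf) _.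
exact: arr_eq_trans (eqm_idm _) (arr_eq_sym (eqm_idm _)).
Qed.

Lemma unit_at_iso (X : fibre E B) : is_iso (unit_at X).
Proof. exact: iso_fmap (iso_eqm _). Qed.

Lemma ounit_nat_sqr (X X' : E) (f : Hom X X') :
  Squash (fmap (ar E) f ≈ fmap (ar E) (fmap (ounit E) (fmap (ar E) f))).
Proof. apply: squash; exact: arr_eq_sym (ofun_arM (ounit E) _). Qed.

Lemma ounit_nat_sql (X X' : E) (f : Hom X X') :
  Squash (fmap (ar E) (fmap (ounit E) (fmap (ar E) f)) ≈ fmap (ar E) f).
Proof. apply: squash; exact: (ofun_arM (ounit E) _). Qed.

Lemma frunit_nat (X X' : fibre E B) (f : Hom X X') :
  f ∘ frunit X = frunit X' ∘ ftens_hom f (idm (funit E B)).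
Proof.
apply: fibre_hom_eq; rewrite /= /frunit_arr cmpA.
have n : fh f ∘ our E (fo X) = our E (fo X') ∘
    tensm (ounit_eqr (fo X)) (ounit_eqr (fo X')) (ounit_nat_sqr (fh f)).
  exact: (nt_nat (our E) (fh f)).
rewrite n -!cmpA; congr (_ ∘ _); rewrite /tensm -!fmap_cmp; congr (fmap _ _).
apply: pb_hom_eq => /=; first by rewrite cmp_idl cmp_idr.
by rewrite unit_at_nat cmp_idr.
Qed.

Lemma flunit_nat (X X' : fibre E B) (f : Hom X X') :
  f ∘ flunit X = flunit X' ∘ ftens_hom (idm (funit E B)) f.
Proof.
apply: fibre_hom_eq; rewrite /= /flunit_arr cmpA.
have n : fh f ∘ oul E (fo X) = oul E (fo X') ∘
    tensm (ounit_eql (fo X)) (ounit_eql (fo X')) (ounit_nat_sql (fh f)).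
  exact: (nt_nat (oul E) (fh f)).
rewrite n -!cmpA; congr (_ ∘ _); rewrite /tensm -!fmap_cmp; congr (fmap _ _).
apply: pb_hom_eq => /=; last by rewrite cmp_idl cmp_idr.
by rewrite unit_at_nat cmp_idr.
Qed.

Lemma fassoc_nat (X X' Y Y' Z Z' : fibre E B)
    (f : Hom X X') (g : Hom Y Y') (h : Hom Z Z') :
  ftens_hom f (ftens_hom g h) ∘ fassoc X Y Z =
  fassoc X' Y' Z' ∘ ftens_hom (ftens_hom f g) h.
Proof.
apply: fibre_hom_eq.
pose fg : @Hom (over_pb E E) (PbOb (fibre_eq X Y)) (PbOb (fibre_eq X' Y')) :=
  @PbHom _ _ _ (PbOb (fibre_eq X Y)) (PbOb (fibre_eq X' Y')) (fh f) (fh g)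
    (fibre_hom_sq f g).
exact: (nt_nat (oas E) (@PbHom _ _ _
  (PbOb (ftens_eq X Y Z)) (PbOb (ftens_eq X' Y' Z')) fg (fh h)
  (fibre_hom_sq f h))).
Qed.

Lemma frunit_iso (X : fibre E B) : is_iso (frunit X).
Proof.
apply: fibre_iso; apply: iso_cmp; first exact: (oiso_iso (our E) (fo X)).
apply: tensm_iso; [|exact: iso_idm|exact: unit_at_iso].
by rewrite fmap_id; exact: arr_eq_refl.
Qed.

Lemma flunit_iso (X : fibre E B) : is_iso (flunit X).
Proof.
apply: fibre_iso; apply: iso_cmp; first exact: (oiso_iso (oul E) (fo X)).
apply: tensm_iso; [|exact: unit_at_iso|exact: iso_idm].
apply: is_identity_fmap; exact: unit_at_id.
Qed.

Lemma fassoc_iso (X Y Z : fibre E B) : is_iso (fassoc X Y Z).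
Proof. by apply: fibre_iso; exact: (oiso_iso (oas E) (PbOb (ftens_eq X Y Z))). Qed.

Definition fibre_monoidal : MonoidalCat := {|
  mcat := fibre E B;
  mtens := ftens E B;
  munit := funit E B;
  mlu := @flunit G E B;
  mru := @frunit G E B;
  mas := @fassoc G E B;
  mlu_nat := flunit_nat;
  mru_nat := frunit_nat;
  mas_nat := fassoc_nat;
  mlu_iso := flunit_iso;
  mru_iso := frunit_iso;
  mas_iso := fassoc_iso;
  mpentagon := @opentagon G E B;
  mtriangle := @otriangle G E B |}.

End FibreMonoidal.

Definition liberal_over (G : Category) (E : MonoidalOverCat G) : Prop :=
  forall B : G,
    [/\ liberal (fibre_monoidal E B),
        preserves_coequalizers (fibre_incl E B) &
        preserves_colimits omega (fibre_incl E B)].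

Lemma ounit_arr_over (G : Category) (E : MonoidalOverCat G) (B B' : G) (b : Hom B B') :
  Squash (fmap (ar E) (fmap (ounit E) b) ≈ b).
Proof. by apply: squash; exact: (ofun_arM (ounit E) b). Qed.

Definition unit_arr (G : Category) (E : MonoidalOverCat G) (B B' : G) (b : Hom B B') :
    afibre E b :=
  @AFibreOb _ _ _ _ b (funit E B) (funit E B') (fmap (ounit E) b) (ounit_arr_over E b).

Section OverMonoids.
Variables (G : Category) (E : MonoidalOverCat G).

Record OverMonoid := {
  om_base : G;
  om_mon : Monoid (fibre_monoidal E om_base) }.

Definition om_fob (C : OverMonoid) : fibre E (om_base C) := om_mon C.
Definition om_car (C : OverMonoid) : E := fo (om_fob C).
Definition om_mul (C : OverMonoid) :
    Hom (tens (fibre_eq (om_fob C) (om_fob C))) (om_car C) :=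
  fh (mo_mul (om_mon C)).
Definition om_one (C : OverMonoid) : Hom (ounit E (om_base C)) (om_car C) :=
  fh (mo_one (om_mon C)).

Record OverMonoidHom (C C' : OverMonoid) := OverMonHom {
  omh_base : Hom (om_base C) (om_base C');
  omh_arr : Hom (om_car C) (om_car C');
  omh_over : fmap (ar E) omh_arr ≈ omh_base;
  omh_mul : omh_arr ∘ om_mul C =
    om_mul C' ∘ tensm (fibre_eq (om_fob C) (om_fob C))
                      (fibre_eq (om_fob C') (om_fob C'))
                      (squash (arr_eq_refl (f := fmap (ar E) omh_arr)));
  omh_one : omh_arr ∘ om_one C = om_one C' ∘ fmap (ounit E) omh_base }.

Lemma omh_eq (C C' : OverMonoid) (f g : OverMonoidHom C C') :
  omh_base f = omh_base g -> omh_arr f = omh_arr g -> f = g.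
Proof.
case: f => f0 f f1 f2 f3; case: g => g0 g g1 g2 g3 /= e0 e; subst g0 g.
by rewrite (proof_irrelevance _ f1 g1) (proof_irrelevance _ f2 g2)
  (proof_irrelevance _ f3 g3).
Qed.

Definition omh_id (C : OverMonoid) : OverMonoidHom C C.
Proof.
exists (idm (om_base C)) (idm (om_car C)).
- abstract (by rewrite fmap_id; apply: eq_idm; exact: unsquash (fo_over (om_fob C))).
- abstract (rewrite cmp_idl -[LHS]cmp_idr; congr (_ ∘ _); rewrite -fmap_id;
    congr (fmap _ _); exact: pb_hom_eq).
- abstract (by rewrite fmap_id cmp_idl cmp_idr).
Defined.

Definition omh_cmp (C C' C'' : OverMonoid) (g : OverMonoidHom C' C'')
  (f : OverMonoidHom C C') : OverMonoidHom C C''.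
Proof.
exists (omh_base g ∘ omh_base f) (omh_arr g ∘ omh_arr f).
- abstract (by rewrite fmap_cmp; exact: arr_eq_cmp (omh_over g) (omh_over f)).
- abstract (rewrite -cmpA omh_mul cmpA omh_mul -cmpA; congr (_ ∘ _);
    rewrite /tensm -fmap_cmp; congr (fmap _ _); exact: pb_hom_eq).
- abstract (by rewrite -cmpA omh_one cmpA omh_one fmap_cmp cmpA).
Defined.

Definition overmonoid_cat : Category.
Proof.
exists OverMonoid OverMonoidHom omh_id omh_cmp.
- abstract (by move=> C C' f; apply: omh_eq; exact: cmp_idl).
- abstract (by move=> C C' f; apply: omh_eq; exact: cmp_idr).
- abstract (by move=> A B C D h g f; apply: omh_eq; exact: cmpA).
Defined.

Definition overmonoid_arity : Functor overmonoid_cat G :=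
  @Build_Functor overmonoid_cat G om_base omh_base
    (fun _ => erefl) (fun _ _ _ _ _ => erefl).

Definition overmonoids : OverCat G :=
  {| otot := overmonoid_cat; ar := overmonoid_arity |}.

Definition forget_functor : Functor overmonoids E :=
  @Build_Functor overmonoids E om_car omh_arr
    (fun _ => erefl) (fun _ _ _ _ _ => erefl).

Lemma forget_ar : functor_eq (functor_comp (ar E) forget_functor) (ar overmonoids).
Proof.
split=> [C|C C' f]; last exact: omh_over.
exact: unsquash (fo_over (om_fob C)).
Qed.

Definition forget : OverFunctor overmonoids E :=
  {| ofun := forget_functor; ofun_ar := forget_ar |}.

End OverMonoids.

(* Main.v *)
Require Import Defs.
Set Warnings "-notation-overridden".
From mathcomp Require Import ssreflect ssrfun ssrbool eqtype ssrnat.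
From Stdlib Require Import StrictProp Classical_Prop ClassicalEpsilon.

Set Implicit Arguments.
Unset Strict Implicit.
Unset Printing Implicit Defensive.

(** The free overmonoid on an object [X] over [B] is the free monoid on [X] in
    the fibre over [B]; what has to be explained is why that monoid exists and
    why it is universal for arrows lying over arbitrary arrows of the base.

    Existence.  As [I(B)] is initial, [X] carries a point [p : I -> X], and so
    [T := X ⊗ -] is a pointed endofunctor of the fibre.  It preserves sequential
    colimits, hence Kelly's sequence
    [I -> T I -> X_2 -> ...], each term of which is a quotient of [T] applied to
    the previous one, converges after omega steps to a free [T]-algebra [F] on
    [I] ([free_algebra]).  Since each [- ⊗ Y] preserves the coequalizers and
    sequential colimits used, [F ⊗ Y] is the free [T]-algebra on [Y]; for [Y := F]
    this yields the multiplication of [F], and for other [Y] the uniqueness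
    from which the monoid laws follow.

    Universality.  Arrows of the total category over a fixed [b : B -> B'] form a
    profunctor from the fibre over [B] to the fibre over [B'], which is monoidal
    because the tensor product and the unit are functors over the base
    ([over_prof]).  The inclusions of the fibres preserve the relevant colimits,
    so this profunctor takes them to limits in its first variable
    ([over_prof_continuous]).  The universal property of [F] is proved against
    every such monoidal profunctor ([free_monoid]): all that the recursive
    construction of an arrow out of [F] requires is a presheaf sending the
    colimits in the construction to limits, together with an operation playing
    the part of a [T]-algebra structure.  Initiality of [I(b)] says
    that an arrow over [b] from [X] to an overmonoid automatically respects the
    points.

    Overmonadicity.  An algebra [a : M x -> x] of the induced monad exhibits [x]
    as a retract, by the unit of the monad, of the monoid [M x], and [a]
    is compatible with the multiplication transported along it; this forces the
    monoid laws on [x] ([retract_monoid]).  The construction inverts the comparison on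
    the nose, because an overmonoid is determined by its carrier,
    multiplication and unit ([overmonoid_eq]). *)

(** * Composites, isomorphisms and initial objects *)

Lemma reassoc (C : Category) (x y z : C) (g : Hom y z) (f : Hom x y) (k : Hom x z) :
  g ∘ f = k -> forall (w : C) (u : Hom w x), g ∘ (f ∘ u) = k ∘ u.
Proof. by move=> <- w u; rewrite cmpA. Qed.

Lemma split_epi (C : Category) (x y z : C) (r : Hom x y) (i : Hom y x) (f g : Hom y z) :
  r ∘ i = idm y -> f ∘ r = g ∘ r -> f = g.
Proof. by move=> ri e; rewrite -[f]cmp_idr -[g]cmp_idr -ri !cmpA e. Qed.

Lemma iso_epi (C : Category) (x y z : C) (i : Hom x y) (f g : Hom y z) :
  is_iso i -> f ∘ i = g ∘ i -> f = g.
Proof. by case=> j [_ ij]; exact: split_epi ij. Qed.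

Lemma iso_mono (C : Category) (x y z : C) (i : Hom y z) (f g : Hom x y) :
  is_iso i -> i ∘ f = i ∘ g -> f = g.
Proof.
by case=> j [ji _] e; rewrite -[f]cmp_idl -[g]cmp_idl -ji -!cmpA e.
Qed.

Lemma initial_eq (C : Category) (x y : C) (f g : Hom x y) : is_initial x -> f = g.
Proof. by move=> /(_ y) [k uk]; rewrite (uk f) (uk g). Qed.

Notation "X ⊗ Y" := (fob (mtens _) (X, Y)) (at level 38, left associativity) : cat_scope.
Notation "f ⊠ g" := (mtm f g) (at level 38, left associativity) : cat_scope.

(** * Coherence of the units *)

Section Coherence.
Variable V : MonoidalCat.

Lemma mtm_cmp (X X' X'' Y Y' Y'' : V) (f' : Hom X' X'') (f : Hom X X')
    (g' : Hom Y' Y'') (g : Hom Y Y') :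
  (f' ⊠ g') ∘ (f ⊠ g) = (f' ∘ f) ⊠ (g' ∘ g).
Proof.
exact: esym (@fmap_cmp _ _ (mtens V) (X, Y) (X', Y') (X'', Y'') (f', g') (f, g)).
Qed.

Lemma mtm_id (X Y : V) : idm X ⊠ idm Y = idm (X ⊗ Y).
Proof. exact: (@fmap_id _ _ (mtens V) (X, Y)). Qed.

Lemma mtm_split (X X' Y Y' : V) (f : Hom X X') (g : Hom Y Y') :
  (f ⊠ idm Y') ∘ (idm X ⊠ g) = (idm X' ⊠ g) ∘ (f ⊠ idm Y).
Proof. by rewrite !mtm_cmp !cmp_idl !cmp_idr. Qed.

Lemma masE (X X' Y Y' Z Z' : V) (f : Hom X X') (g : Hom Y Y') (h : Hom Z Z') :
  mas X' Y' Z' ∘ ((f ⊠ g) ⊠ h) = (f ⊠ (g ⊠ h)) ∘ mas X Y Z.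
Proof. exact: esym (mas_nat _ _ _). Qed.

Lemma mluE (X X' : V) (f : Hom X X') : mlu X' ∘ (idm _ ⊠ f) = f ∘ mlu X.
Proof. exact: esym (mlu_nat _). Qed.

Lemma mruE (X X' : V) (f : Hom X X') : mru X' ∘ (f ⊠ idm _) = f ∘ mru X.
Proof. exact: esym (mru_nat _). Qed.

Lemma pentagonE (W X Y Z : V) :
  (idm W ⊠ mas X Y Z) ∘ (mas W (X ⊗ Y) Z ∘ (mas W X Y ⊠ idm Z)) =
  mas W X (Y ⊗ Z) ∘ mas (W ⊗ X) Y Z.
Proof. by rewrite cmpA; exact: mpentagon. Qed.

Lemma triangleE (X Y : V) : (idm X ⊠ mlu Y) ∘ mas X (munit V) Y = mru X ⊠ idm Y.
Proof. exact: mtriangle. Qed.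

Lemma mtm_iso (X X' Y Y' : V) (f : Hom X X') (g : Hom Y Y') :
  is_iso f -> is_iso g -> is_iso (f ⊠ g).
Proof.
case=> f' [f1 f2] [g' [g1 g2]]; exists (f' ⊠ g').
by rewrite !mtm_cmp f1 f2 g1 g2 !mtm_id.
Qed.

Lemma munit_faithful_l (X Y : V) (f g : Hom X Y) :
  idm (munit V) ⊠ f = idm (munit V) ⊠ g -> f = g.
Proof.
by move=> e; apply: (iso_epi (mlu_iso X)); rewrite -!mluE e.
Qed.

Lemma munit_faithful_r (X Y : V) (f g : Hom X Y) :
  f ⊠ idm (munit V) = g ⊠ idm (munit V) -> f = g.
Proof.
by move=> e; apply: (iso_epi (mru_iso X)); rewrite -!mruE e.
Qed.

(** Kelly's argument: after tensoring with the unit on the left, which is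
    faithful, the pentagon and the two triangles for [I, X] and [I, X ⊗ Y] fill
    the diagram. *)
Lemma mlu_tens (X Y : V) : mlu (X ⊗ Y) ∘ mas (munit V) X Y = mlu X ⊠ idm Y.
Proof.
apply: munit_faithful_l.
have i : is_iso (mas (munit V) (munit V ⊗ X) Y ∘ (mas (munit V) (munit V) X ⊠ idm Y)).
  by apply: iso_cmp (mas_iso _ _ _) (mtm_iso (mas_iso _ _ _) (iso_idm Y)).
apply: (iso_epi i).
rewrite -[idm (munit V)](cmp_idl (idm _)) -mtm_cmp cmp_idl -cmpA pentagonE.
rewrite cmpA triangleE -[X in mru _ ⊠ X]mtm_id -masE.
rewrite [RHS]cmpA -masE -[RHS]cmpA; congr (_ ∘ _).
by rewrite mtm_cmp triangleE cmp_idl.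
Qed.

(** The mirror image of [mlu_tens], tensoring with the unit on the right. *)
Lemma mru_tens (X Y : V) : (idm X ⊠ mru Y) ∘ mas X Y (munit V) = mru (X ⊗ Y).
Proof.
apply: munit_faithful_r; apply: (iso_mono (mas_iso _ _ _)).
rewrite -{1}[idm (munit V)](cmp_idl (idm _)) -mtm_cmp cmpA masE.
rewrite -triangleE -{1}[idm X](cmp_idl (idm _)) -mtm_cmp -!cmpA pentagonE.
by rewrite -triangleE cmpA -masE mtm_id cmpA.
Qed.

(** Naturality of [mlu] at [mlu I] identifies [mlu (I ⊗ I)] with [I ⊗ mlu I], so
    [mlu_tens] and the triangle give [mlu I ⊗ I = mru I ⊗ I]. *)
Lemma mlu_munit : mlu (munit V) = mru (munit V).
Proof.
apply: munit_faithful_r; rewrite -mlu_tens -triangleE; congr (_ ∘ _).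
by apply: (iso_mono (mlu_iso _)); rewrite mluE.
Qed.

End Coherence.

(** * Sequential diagrams *)

Definition ostep (n : nat) : @Hom omega n n.+1 := leqnSn n.

Section Sequences.
Variable C : Category.

(** The family is shifted in the recursive call, so that no cast is needed. *)
Fixpoint chain (m n : nat) : forall (X : nat -> C) (j : forall k, Hom (X k) (X k.+1)),
    m <= n -> Hom (X m) (X n) :=
  match m, n return forall (X : nat -> C) (j : forall k, Hom (X k) (X k.+1)),
    m <= n -> Hom (X m) (X n) with
  | 0, 0 => fun X j h => idm (X 0)
  | 0, n.+1 => fun X j h => @chain 0 n (fun k => X k.+1) (fun k => j k.+1) h ∘ j 0
  | m.+1, 0 => fun X j h => False_rect _ (notF h)
  | m.+1, n.+1 => fun X j h => @chain m n (fun k => X k.+1) (fun k => j k.+1) h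
  end.

Lemma chain_id (X : nat -> C) (j : forall k, Hom (X k) (X k.+1)) (n : nat) (h : n <= n) :
  chain j h = idm (X n).
Proof. by elim: n X j h => [|n IH] X j h //=; exact: (IH (fun k => X k.+1)). Qed.

Lemma chain_cmp (X : nat -> C) (j : forall k, Hom (X k) (X k.+1)) (m n p : nat)
    (h : n <= p) (h' : m <= n) (h'' : m <= p) :
  chain j h'' = chain j h ∘ chain j h'.
Proof.
elim: p m n X j h h' h'' => [|p IH] [|m] [|n] X j h h' h'' //=.
- by rewrite cmp_idl.
- by rewrite cmp_idr (bool_irrelevance h'' h).
- rewrite cmpA; congr (_ ∘ _); exact: (IH 0 n (fun k => X k.+1)).
- exact: (IH m n (fun k => X k.+1)).
Qed.

Lemma chain_step (X : nat -> C) (j : forall k, Hom (X k) (X k.+1)) (n : nat)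
  (h : n <= n.+1) : chain j h = j n.
Proof.
elim: n X j h => [|n IH] X j h; first by rewrite /= cmp_idl.
exact: (IH (fun k => X k.+1)).
Qed.

Definition chain_functor (X : nat -> C) (j : forall k, Hom (X k) (X k.+1)) :
    Functor omega C := {|
  fob := X : omega -> C;
  fmap := fun m n h => chain j h;
  fmap_id := fun n => chain_id j _;
  fmap_cmp := fun m n p g f => chain_cmp j g f _ |}.

(** An identity into [n.+1] is presented through [eqm], since its source [m] equals
    [n.+1] only propositionally. *)
Lemma omega_step (m n : nat) (P : @Hom omega m n.+1 -> Prop) (h : @Hom omega m n.+1) :
  (forall e : m = n.+1, P (eqm (C := omega) e)) ->
  (forall h' : @Hom omega m n, P (ostep n ∘ h')) -> P h.
Proof.
move=> P1 P2; have := h; rewrite /= leq_eqVlt => /orP[/eqP e|h'].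
- by rewrite (bool_irrelevance h (eqm (C := omega) e)); exact: P1.
- by rewrite (bool_irrelevance h (ostep n ∘ (h' : @Hom omega m n))); exact: P2.
Qed.

Lemma steps_nat (D : Functor omega C) (Y : C) (l : forall n : nat, Hom (D n) Y) :
  (forall n, l n.+1 ∘ fmap D (ostep n) = l n) ->
  forall (m n : nat) (u : @Hom omega m n), l n ∘ fmap D u = l m.
Proof.
move=> hl m; elim=> [|n IH] u.
- case: m u => // u; rewrite (bool_irrelevance u (@idm omega 0)).
  by rewrite fmap_id cmp_idr.
- apply: (@omega_step m n (fun v => l n.+1 ∘ fmap D v = l m)) => [e|h].
  2: by rewrite fmap_cmp cmpA hl IH.
  by case: _ / e => /=; rewrite fmap_id cmp_idr.
Qed.

Definition step_cocone (D : Functor omega C) (Y : C) (l : forall n : nat, Hom (D n) Y)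
    (hl : forall n, l n.+1 ∘ fmap D (ostep n) = l n) : Cocone D :=
  @Build_Cocone omega C D Y l (steps_nat hl).

End Sequences.

(** * Continuous presheaves *)

Record Presheaf (C : Category) := {
  psh :> C -> Type;
  res : forall x y, Hom x y -> psh y -> psh x;
  res_id : forall x (s : psh x), res (idm x) s = s;
  res_cmp : forall x y z (g : Hom y z) (f : Hom x y) (s : psh z),
    res (g ∘ f) s = res f (res g s) }.

(** Compatible families on a sequence are given by their successive steps, as
    recursion produces them. *)
Definition continuous (C : Category) (P : Presheaf C) : Prop :=
  (forall (D : Functor omega C) (c : Cocone D), is_colimit c ->
    forall l : forall n : nat, P (D n),
      (forall n, res (fmap D (ostep n)) (l n.+1) = l n) ->
      exists! s : P (apex c), forall n : nat, res (leg c n) s = l n) /\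
  (forall (x y z : C) (f g : Hom x y) (q : Hom y z), is_coequalizer f g q ->
    forall s : P y, res f s = res g s -> exists! t : P z, res q t = s).

Definition psh_precomp (C D : Category) (F : Functor C D) (P : Presheaf D) : Presheaf C.
Proof.
exists (fun x => P (F x)) (fun x y f => res (fmap F f)).
- abstract (by move=> x s; rewrite fmap_id res_id).
- abstract (by move=> x y z g f s; rewrite fmap_cmp res_cmp).
Defined.

Lemma psh_precomp_continuous (C D : Category) (F : Functor C D) (P : Presheaf D) :
  preserves_colimits omega F -> preserves_coequalizers F ->
  continuous P -> continuous (psh_precomp F P).
Proof.
move=> Fom Fco [Pom Pco]; split=> [J c hc|x y z f g q hq].
- exact: Pom (Fom _ _ hc).
- exact: Pco (Fco _ _ _ _ _ _ hq).
Qed.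

(** * Free algebras for a pointed endofunctor *)

(** For a representable presheaf [Hom(-, D)], naturality makes [pa_op]
    composition with an arrow [T D -> D], so this is a [T]-algebra structure on
    [D].  Allowing other presheaves is what makes the free algebra universal also
    for arrows that leave the category, and for arrows out of [F ⊗ Y]. *)
Record PshAlgebra (C : Category) (T : Functor C C) (τ : NatTrans (functor_id C) T) := {
  pa_psh :> Presheaf C;
  pa_cont : continuous pa_psh;
  pa_op : forall z, pa_psh z -> pa_psh (T z);
  pa_nat : forall x y (f : Hom x y) (s : pa_psh y),
    res (fmap T f) (pa_op s) = pa_op (res f s);
  pa_unit : forall z (s : pa_psh z), res (τ z) (pa_op s) = s }.

Section FreeAlgebra.
Variables (C : Category) (T : Functor C C) (τ : NatTrans (functor_id C) T).
Hypothesis colim : has_colimits omega C.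
Hypothesis coeq : has_coequalizers C.
Hypothesis T_colim : preserves_colimits omega T.

Definition coeq_of (x y : C) (f g : Hom x y) :
  {zq : {z : C & Hom y z} | is_coequalizer f g (projT2 zq)}.
Proof.
apply: constructive_indefinite_description.
by have [z [q hq]] := coeq f g; exists (existT _ z q).
Qed.

Record stage := Stage {
  st_src : C;
  st_tgt : C;
  st_act : Hom (T st_src) st_tgt }.

Definition st_emb (s : stage) : Hom (st_src s) (st_tgt s) := st_act s ∘ τ (st_src s).

(** The universal quotient of [T X_(n+1)] in which the action [T X_n -> X_(n+1)]
    commutes with the transition maps; the point of [T] provides both the
    transition maps and one arrow of the coequalized pair. *)
Definition next (s : stage) : stage :=
  Stage (projT2 (sval (coeq_of (τ (st_tgt s) ∘ st_act s) (fmap T (st_emb s))))).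

Variable A : C.

Definition tower (n : nat) : stage := iter n next (Stage (idm (T A))).
Definition tow (n : nat) : C := st_src (tower n).
Definition tow_act (n : nat) : Hom (T (tow n)) (tow n.+1) := st_act (tower n).
Definition tow_emb (n : nat) : Hom (tow n) (tow n.+1) := st_emb (tower n).

Lemma tow_coeq (n : nat) :
  is_coequalizer (τ (tow n.+1) ∘ tow_act n) (fmap T (tow_emb n)) (tow_act n.+1).
Proof. exact: svalP (coeq_of _ _). Qed.

Lemma tow_emb_act (n : nat) : tow_emb n.+1 ∘ tow_act n = tow_act n.+1 ∘ fmap T (tow_emb n).
Proof. by rewrite -(proj1 (tow_coeq n)) cmpA. Qed.

(** Every action of the tower is an identity or a coequalizer, so a continuous
    presheaf restricts injectively along it. *)
Lemma tow_act_mono (P : Presheaf C) (n : nat) (s t : P (tow n.+1)) :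
  continuous P -> res (tow_act n) s = res (tow_act n) t -> s = t.
Proof.
move=> [_ Pco]; case: n s t => [|n] s t e; first by move: e; rewrite !res_id.
have [|r [_ ur]] := Pco _ _ _ _ _ _ (tow_coeq n) (res (tow_act n.+1) s).
  by rewrite -!res_cmp (proj1 (tow_coeq n)).
by rewrite -(ur s) // -(ur t).
Qed.

Section Extension.
Variables (P : PshAlgebra τ) (g : P A).

(** A consecutive pair of values of the extension of [g]: constructing the next
    value needs the equation that links the last two. *)
Definition sect (n : nat) := {ss : P (tow n) * P (tow n.+1) |
  res (tow_act n) ss.2 = pa_op ss.1}.

Definition sect0 : sect 0.
Proof. by exists (g, pa_op g); exact: res_id. Defined.

Lemma sect_ex (n : nat) (s : sect n) :
  {t : P (tow n.+2) | res (tow_act n.+1) t = pa_op (sval s).2}.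
Proof.
apply: constructive_indefinite_description; case: s => [[s s'] /= e].
  (* Both restrictions of [pa_op s'] along the coequalized pair are [pa_op s],
     by [e] and the unit law. *)
have [|t [ht _]] := proj2 (pa_cont P) _ _ _ _ _ _ (tow_coeq n) (pa_op s').
  by rewrite res_cmp pa_unit pa_nat /tow_emb /st_emb res_cmp e pa_unit.
by exists t.
Qed.

Definition sectS (n : nat) (s : sect n) : sect n.+1 :=
  exist (fun ss : P (tow n.+1) * P (tow n.+2) => res (tow_act n.+1) ss.2 = pa_op ss.1)
    ((sval s).2, sval (sect_ex s)) (svalP (sect_ex s)).

Fixpoint sects (n : nat) : sect n :=
  match n with 0 => sect0 | n.+1 => sectS (sects n) end.

Definition ext (n : nat) : P (tow n) := (sval (sects n)).1.

Lemma ext_act (n : nat) : res (tow_act n) (ext n.+1) = pa_op (ext n).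
Proof. exact: svalP (sects n). Qed.

Lemma ext_emb (n : nat) : res (tow_emb n) (ext n.+1) = ext n.
Proof. by rewrite /tow_emb /st_emb res_cmp ext_act pa_unit. Qed.

End Extension.

(** The actions of the tower commute with its transition maps; as [T] preserves
    the colimit, they induce an action on it.  A morphism out of the
    colimit is forced stage by stage by its value on [A]. *)
Theorem free_algebra :
  exists (F : C) (a : Hom (T F) F) (e : Hom A F), a ∘ τ F = idm F /\
    forall (P : PshAlgebra τ) (g : P A),
      exists! h : P F, res e h = g /\ res a h = pa_op h.
Proof.
pose D := chain_functor tow_emb.
have Dstep n : fmap D (ostep n) = tow_emb n by exact: chain_step.
have TDstep n : fmap (functor_comp T D) (ostep n) = fmap T (tow_emb n).
  by rewrite -Dstep.
have [c hc] := colim D; have hTc := T_colim hc.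
have lstep n : leg c n.+1 ∘ tow_emb n = leg c n by rewrite -Dstep; exact: (leg_nat c (ostep n)).
have astep : forall n, (leg c n.+2 ∘ tow_act n.+1) ∘
    fmap (functor_comp T D) (ostep n) = leg c n.+1 ∘ tow_act n.
  move=> n; by rewrite -cmpA TDstep -tow_emb_act cmpA lstep.
have [a [ha ua]] := hTc (step_cocone
  (D := functor_comp T D) (l := fun n => leg c n.+1 ∘ tow_act n) astep).
rewrite /= in a ha ua.
exists (apex c), a, (leg c 0); split.
  have [i [_ ui]] := hc c.
  rewrite -(ui (idm _)) => [|n]; last by rewrite cmp_idl.
  apply/esym/ui => n; rewrite -cmpA.
  have /= <- := nt_nat τ (leg c n).
  by rewrite cmpA ha -cmpA; exact: lstep.
move=> P g.
have [|h [hh uh]] := proj1 (pa_cont P) _ _ hc (ext g).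
  by move=> n; rewrite Dstep ext_emb.
exists h; split.
- split; first exact: hh 0.
  have [|r [_ ur]] := proj1 (pa_cont P) _ _ hTc (fun n => pa_op (ext g n)).
    by move=> n; rewrite TDstep pa_nat ext_emb.
  rewrite -(ur (pa_op h)) => [|n].
    apply/esym/ur => n; rewrite -res_cmp [leg _ _]/= ha res_cmp (hh n.+1).
    exact: ext_act.
  by rewrite (pa_nat (leg c n) h) (hh n).
- move=> h' [h'0 h'a]; apply: uh; elim=> [//|n IH].
  apply: (tow_act_mono (pa_cont P)).
  by rewrite ext_act -IH -pa_nat -h'a -!res_cmp ha.
Qed.

End FreeAlgebra.

(** * Monoidal profunctors *)

(** Heteromorphisms from [V] to [W] that can be composed with arrows on both sides
    and tensored.  They abstract the arrows between two fibres that lie over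
    a given arrow of the base. *)
Record MonoidalProfunctor (V W : MonoidalCat) := {
  prof :> V -> W -> Type;
  lact : forall X Y Y', Hom Y Y' -> prof X Y -> prof X Y';
  ract : forall X X' Y, prof X Y -> Hom X' X -> prof X' Y;
  lact_cmp : forall X Y Y' Y'' (v : Hom Y' Y'') (v' : Hom Y Y') (f : prof X Y),
    lact (v ∘ v') f = lact v (lact v' f);
  ract_id : forall X Y (f : prof X Y), ract f (idm X) = f;
  ract_cmp : forall X X' X'' Y (f : prof X Y) (u : Hom X' X) (u' : Hom X'' X'),
    ract f (u ∘ u') = ract (ract f u) u';
  lact_id : forall X Y (f : prof X Y), lact (idm Y) f = f;
  lract : forall X X' Y Y' (v : Hom Y Y') (f : prof X Y) (u : Hom X' X),
    ract (lact v f) u = lact v (ract f u);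
  punit : prof (munit V) (munit W);
  ptens : forall X X' Y Y', prof X Y -> prof X' Y' -> prof (X ⊗ X') (Y ⊗ Y');
  ptens_lact : forall X X' Y Y' Z Z' (v : Hom Y Z) (v' : Hom Y' Z')
      (f : prof X Y) (f' : prof X' Y'),
    ptens (lact v f) (lact v' f') = lact (v ⊠ v') (ptens f f');
  ptens_ract : forall X X' Y Y' Z Z' (f : prof X Y) (f' : prof X' Y')
      (u : Hom Z X) (u' : Hom Z' X'),
    ptens (ract f u) (ract f' u') = ract (ptens f f') (u ⊠ u');
  ptens_mas : forall X X' X'' Y Y' Y'' (f : prof X Y) (f' : prof X' Y') (f'' : prof X'' Y''),
    lact (mas Y Y' Y'') (ptens (ptens f f') f'') =
    ract (ptens f (ptens f' f'')) (mas X X' X'');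
  ptens_mlu : forall X Y (f : prof X Y), lact (mlu Y) (ptens punit f) = ract f (mlu X);
  ptens_mru : forall X Y (f : prof X Y), lact (mru Y) (ptens f punit) = ract f (mru X) }.

Arguments punit {V W} m.

Notation "v ◃ f" := (lact v f) (at level 41, right associativity) : cat_scope.
Notation "f ▹ u" := (ract f u) (at level 40, left associativity) : cat_scope.

Definition prof_psh (V W : MonoidalCat) (H : MonoidalProfunctor V W) (D : W) : Presheaf V := {|
  psh := fun X => H X D;
  res := fun X Y u f => f ▹ u;
  res_id := fun X f => ract_id f;
  res_cmp := fun X Y Z g f s => ract_cmp s g f |}.

Definition prof_continuous (V W : MonoidalCat) (H : MonoidalProfunctor V W) : Prop :=
  forall D : W, continuous (prof_psh H D).

Definition hom_prof (V : MonoidalCat) : MonoidalProfunctor V V.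
Proof.
exists (fun X Y => Hom X Y) (fun X Y Y' v f => v ∘ f) (fun X X' Y f u => f ∘ u)
  (idm (munit V)) (fun X X' Y Y' f f' => f ⊠ f').
all: abstract (move=> *; rewrite ?mtm_cmp ?cmp_idl ?cmp_idr ?cmpA ?masE ?mluE ?mruE //).
Defined.

Lemma hom_prof_continuous (V : MonoidalCat) : prof_continuous (hom_prof V).
Proof.
move=> D; split=> [J c hc l hl|x y z f g q [_ hq] s]; last exact: hq.
exact: hc (step_cocone (D := J) hl).
Qed.

(** * Free monoids *)

Section PointedTensor.
Variables (V : MonoidalCat) (X : V) (p : Hom (munit V) X).

Definition mlu_inv (Z : V) : {g | g ∘ mlu Z = idm _ /\ mlu Z ∘ g = idm Z}.
Proof. exact: constructive_indefinite_description (mlu_iso Z). Qed.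

(** The point of [X ⊗ -] induced by the point [p] of [X]. *)
Definition insert (Z : V) : Hom Z (X ⊗ Z) := (p ⊠ idm Z) ∘ sval (mlu_inv Z).

Lemma insert_mlu (Z : V) : insert Z ∘ mlu Z = p ⊠ idm Z.
Proof. by rewrite /insert -cmpA (proj1 (svalP (mlu_inv Z))) cmp_idr. Qed.

Lemma insert_nat (Z Z' : V) (f : Hom Z Z') :
  (idm X ⊠ f) ∘ insert Z = insert Z' ∘ f.
Proof.
apply: (iso_epi (mlu_iso Z)); rewrite -cmpA insert_mlu -cmpA -mluE cmpA insert_mlu.
by rewrite !mtm_cmp !cmp_idl !cmp_idr.
Qed.

Definition insertion : NatTrans (functor_id V) (tensor_left X) :=
  {| ntc := insert : forall Z, Hom (functor_id V Z) (tensor_left X Z);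
     nt_nat := insert_nat |}.

(** This is where [mlu_tens] is needed: the point of [X ⊗ -] at [Z ⊗ Y] comes
    from the point at [Z]. *)
Lemma insert_tens (Z Y : V) : mas X Z Y ∘ (insert Z ⊠ idm Y) = insert (Z ⊗ Y).
Proof.
apply: (iso_epi (i := mlu Z ⊠ idm Y)); first exact: mtm_iso (mlu_iso _) (iso_idm _).
rewrite -cmpA mtm_cmp insert_mlu cmp_idl masE mtm_id.
by rewrite -insert_mlu -cmpA mlu_tens.
Qed.

Hypothesis right_colim : forall Y, preserves_colimits omega (tensor_right (V := V) Y).
Hypothesis right_coeq : forall Y, preserves_coequalizers (tensor_right (V := V) Y).

(** Morphisms from the free algebra [F] into this algebra are morphisms from
    [F ⊗ Y] into [P]; freeness of [F] against it thus says that [F ⊗ Y] is free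
    on [I ⊗ Y]. *)
Definition shift (Y : V) (P : PshAlgebra insertion) : PshAlgebra insertion.
Proof.
exists (psh_precomp (tensor_right Y) P)
  (fun Z (s : P (Z ⊗ Y)) => res (mas X Z Y) (pa_op s : P (X ⊗ (Z ⊗ Y)))).
- abstract exact: psh_precomp_continuous (@right_colim Y) (@right_coeq Y) (pa_cont P).
- abstract (by move=> Z Z' f s; rewrite /= -res_cmp masE res_cmp; congr res;
    exact: (pa_nat (fmap (tensor_right Y) f) s)).
- abstract (by move=> Z s; rewrite /= -res_cmp insert_tens; exact: (pa_unit s)).
Defined.

Section ProfAlgebra.
Variables (W : MonoidalCat) (H : MonoidalProfunctor V W) (Hcont : prof_continuous H).
Variables (N D : W) (act : Hom (N ⊗ D) D) (u : Hom (munit W) N) (f : H X N).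
Hypothesis act_unit : act ∘ (u ⊠ idm D) = mlu D.
Hypothesis f_point : f ▹ p = u ◃ punit H.

Lemma prof_act_unit (Z : V) (s : H Z D) :
  (act ◃ ptens f s) ▹ (p ⊠ idm Z) = s ▹ mlu Z.
Proof.
rewrite lract -ptens_ract ract_id f_point -[s in ptens _ s]lact_id ptens_lact.
by rewrite -lact_cmp act_unit ptens_mlu.
Qed.

(** An action of [N] on [D] and an element of [H X N] respecting the points let [X]
    act on [H Z D].  With [N := X] and [H] the hom profunctor this covers
    the algebra [F] itself, and with [N := D] it covers a monoid receiving [X]. *)
Definition prof_algebra : PshAlgebra insertion.
Proof.
exists (prof_psh H D) (fun Z s => act ◃ ptens f s).
- abstract exact: Hcont.
- abstract (by move=> Z Z' g s; rewrite /= lract -ptens_ract ract_id).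
- abstract (move=> Z s; rewrite /= /insert ract_cmp prof_act_unit -ract_cmp;
    by rewrite (proj2 (svalP (mlu_inv Z))) ract_id).
Defined.

End ProfAlgebra.

Section Multiplication.
Variables (F : V) (a : Hom (X ⊗ F) F) (e : Hom (munit V) F).
Hypothesis a_insert : a ∘ insert F = idm F.
Hypothesis F_free : forall (P : PshAlgebra insertion) (g : P (munit V)),
  exists! h : P F, res e h = g /\ res a h = pa_op h.

(** Induction on the free algebra; applied to an iterated [shift], it compares
    arrows out of [F ⊗ Y] or [(F ⊗ Y) ⊗ Z], as in the monoid laws of [F]. *)
Lemma free_eq (P : PshAlgebra insertion) (h h' : P F) :
  res e h = res e h' -> res a h = pa_op h -> res a h' = pa_op h' -> h = h'.
Proof.
move=> e0 ea ea'; have [k [_ uk]] := F_free (res e h).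
by rewrite -(uk h) // -(uk h').
Qed.

Lemma act_point : a ∘ (p ⊠ idm F) = mlu F.
Proof. by rewrite -insert_mlu cmpA a_insert cmp_idl. Qed.

Definition self_algebra : PshAlgebra insertion.
Proof.
apply: (@prof_algebra V (hom_prof V) (@hom_prof_continuous V) X F a p (idm X)).
- exact: act_point.
- abstract (by rewrite /= cmp_idl cmp_idr).
Defined.

(** Left multiplication extends the action of the generators on [F] to [F]. *)
Lemma mul_ex : {m : Hom (F ⊗ F) F |
  m ∘ (e ⊠ idm F) = mlu F /\ m ∘ (a ⊠ idm F) = a ∘ (idm X ⊠ m) ∘ mas X F F}.
Proof.
apply: constructive_indefinite_description.
by have [m [hm _]] := @F_free (shift F self_algebra) (mlu F); exists m.
Qed.

Definition mul : Hom (F ⊗ F) F := sval mul_ex.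

Lemma mul_unitl : mul ∘ (e ⊠ idm F) = mlu F.
Proof. exact: proj1 (svalP mul_ex). Qed.

Lemma mul_act : mul ∘ (a ⊠ idm F) = a ∘ (idm X ⊠ mul) ∘ mas X F F.
Proof. exact: proj2 (svalP mul_ex). Qed.

Lemma mul_unitr : mul ∘ (idm F ⊠ e) = mru F.
Proof.
apply: (@free_eq (shift (munit V) self_algebra)) => /=.
- by rewrite -cmpA -mtm_split cmpA mul_unitl mluE mruE mlu_munit.
- rewrite -cmpA -mtm_split cmpA mul_act -[idm (X ⊗ F)]mtm_id -!cmpA masE.
  by rewrite (reassoc (mtm_cmp _ _ _ _)) cmp_idl.
- by rewrite mruE -mru_tens cmpA.
Qed.

Lemma mul_assoc : mul ∘ (mul ⊠ idm F) = mul ∘ (idm F ⊠ mul) ∘ mas F F F.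
Proof.
apply: (@free_eq (shift F (shift F self_algebra))) => /=.
- rewrite -cmpA mtm_cmp cmp_idl mul_unitl.
  rewrite -!cmpA masE mtm_id (reassoc (esym (mtm_split _ _))) -!cmpA.
  by rewrite (reassoc mul_unitl) (reassoc (mluE _)) -cmpA mlu_tens.
- rewrite -cmpA mtm_cmp cmp_idl mul_act -[idm F in LHS](cmp_idl (idm F)) -mtm_cmp.
  rewrite -[idm F in LHS](cmp_idl (idm F)) -mtm_cmp !cmpA mul_act.
  rewrite -!cmpA; congr (_ ∘ _); rewrite (reassoc (masE _ _ _)) -!cmpA.
  by rewrite (reassoc (mtm_cmp _ _ _ _)) !cmp_idl.
- rewrite -!cmpA masE mtm_id (reassoc (esym (mtm_split _ _))) -!cmpA.
  rewrite (reassoc mul_act) -[idm (X ⊗ F)]mtm_id -!cmpA (reassoc (masE _ _ _)) -!cmpA.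
  congr (_ ∘ _); rewrite -pentagonE (reassoc (mtm_cmp _ _ _ _)).
  by rewrite (reassoc (mtm_cmp _ _ _ _)) !cmp_idl -(cmpA mul).
Qed.

Definition free_mon : Monoid V :=
  {| mo_car := F; mo_mul := mul; mo_one := e;
     mo_assoc := mul_assoc; mo_unitl := mul_unitl; mo_unitr := mul_unitr |}.

Definition mru_inv (Z : V) : {g | g ∘ mru Z = idm _ /\ mru Z ∘ g = idm Z}.
Proof. exact: constructive_indefinite_description (mru_iso Z). Qed.

(** The image of the one-letter words in [F]. *)
Definition gen : Hom X F := a ∘ (idm X ⊠ e) ∘ sval (mru_inv X).

Lemma gen_mru : gen ∘ mru X = a ∘ (idm X ⊠ e).
Proof. by rewrite /gen -cmpA (proj1 (svalP (mru_inv X))) cmp_idr. Qed.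

(** The action of [X] on [F] is left multiplication by generators, hence a
    morphism of monoids is determined by its restriction along [gen]. *)
Lemma mul_gen : mul ∘ (gen ⊠ idm F) = a.
Proof.
apply: (iso_epi (i := mru X ⊠ idm F)); first exact: mtm_iso (mru_iso _) (iso_idm _).
rewrite -cmpA mtm_cmp gen_mru -mtm_cmp cmpA mul_act -!cmpA masE.
by rewrite (reassoc (mtm_cmp _ _ _ _)) mul_unitl !cmp_idl triangleE.
Qed.

Section Universal.
Variables (W : MonoidalCat) (H : MonoidalProfunctor V W) (Hcont : prof_continuous H).
Variables (C : Monoid W) (f : H X C).
Hypothesis f_point : f ▹ p = mo_one C ◃ punit H.

Definition target : PshAlgebra insertion :=
  prof_algebra Hcont (mo_unitl C) f_point.

(** Both sides are morphisms of algebras out of [F ⊗ F] that restrict on [I ⊗ F]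
    to [h] preceded by the unit isomorphism; for the right-hand side this uses associativity in [C]. *)
Lemma free_mon_hom (h : H F C) :
  h ▹ e = mo_one C ◃ punit H -> h ▹ a = mo_mul C ◃ ptens f h ->
  h ▹ mul = mo_mul C ◃ ptens h h.
Proof.
move=> he ha; apply: (@free_eq (shift F target)) => /=.
- rewrite -ract_cmp mul_unitl lract -ptens_ract he ract_id.
  by rewrite -[h in ptens _ h]lact_id ptens_lact -lact_cmp mo_unitl ptens_mlu.
- by rewrite -ract_cmp mul_act !ract_cmp ha lract -ptens_ract ract_id.
- rewrite lract -ptens_ract ha ract_id -[h in X in _ ◃ X = _]lact_id ptens_lact.
  rewrite -lact_cmp mo_assoc !lact_cmp ptens_mas !lract.
  by rewrite lact_id -[f in RHS]lact_id ptens_lact lract.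
Qed.

Theorem free_mon_universal :
  exists! h : H F C, [/\ h ▹ gen = f, h ▹ mul = mo_mul C ◃ ptens h h &
    h ▹ e = mo_one C ◃ punit H].
Proof.
have [h [[he ha] uh]] := @F_free target (mo_one C ◃ punit H).
rewrite /= in he ha; exists h; split=> [|k [kg km ke]].
  split=> //; last exact: free_mon_hom.
  rewrite /gen !ract_cmp ha lract -ptens_ract he ract_id -[f in X in X ▹ _]lact_id.
  rewrite ptens_lact -lact_cmp mo_unitr ptens_mru -ract_cmp.
  by rewrite (proj2 (svalP (mru_inv X))) ract_id.
apply: uh; split=> //=.
by rewrite -{1}mul_gen ract_cmp km lract -ptens_ract kg ract_id.
Qed.

End Universal.
End Multiplication.
End PointedTensor.

(** For the hom profunctor of [V] this is the usual universal property of the free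
    monoid on a pointed object. *)
Theorem free_monoid (V : MonoidalCat) (X : V) (p : Hom (munit V) X) :
  liberal V ->
  exists (F : Monoid V) (η : Hom X F),
    forall (W : MonoidalCat) (H : MonoidalProfunctor V W) (C : Monoid W) (f : H X C),
      prof_continuous H -> f ▹ p = mo_one C ◃ punit H ->
      exists! h : H F C, [/\ h ▹ η = f, h ▹ mo_mul F = mo_mul C ◃ ptens h h &
        h ▹ mo_one F = mo_one C ◃ punit H].
Proof.
move=> [[colim coeq] right_colim left_colim right_coeq].
have [F [a [e [a_ins F_free]]]] :=
  free_algebra (insertion p) colim coeq (left_colim X) (munit V).
exists (free_mon right_colim right_coeq a_ins F_free), (gen a e) => W H C f Hc fp.
exact: free_mon_universal.
Qed.

(** * Arrows of the total category over a fixed arrow of the base *)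

Section ArrEqExtra.
Variable C : Category.

Lemma arr_eq_idr (x y z : C) (g : Hom y z) (f : Hom x y) :
  is_identity f -> g ∘ f ≈ g.
Proof.
move=> hf; have ez := arr_eq_tgt hf; subst.
by rewrite (arr_eqP hf) cmp_idr; exact: arr_eq_refl.
Qed.

Lemma is_identity_at (x y z : C) (f : Hom x y) : f ≈ idm z -> is_identity f.
Proof. by move=> h; exact: arr_eq_trans h (eq_idm (esym (arr_eq_src h))). Qed.

End ArrEqExtra.

Section OverHom.
Variables (G : Category) (E : MonoidalOverCat G).

Lemma fibre_identity (B : G) (X Y : fibre E B) (f : Hom X Y) :
  is_identity (fmap (ar E) (fh f)).
Proof. exact: is_identity_at (unsquash (fh_over f)). Qed.

Section FixedArrow.
Variables (B B' : G) (b : Hom B B').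

Set Primitive Projections.
Record over_hom (X : fibre E B) (Y : fibre E B') := OverHom {
  oh : Hom (fo X) (fo Y);
  oh_over : Squash (fmap (ar E) oh ≈ b) }.
Unset Primitive Projections.

Lemma over_hom_eq (X : fibre E B) (Y : fibre E B') (f g : over_hom X Y) :
  oh f = oh g -> f = g.
Proof. by case: f => f hf; case: g => g hg /= e; subst g. Qed.

Lemma over_hom_sq (X X' : fibre E B) (Y Y' : fibre E B')
    (f : over_hom X Y) (g : over_hom X' Y') :
  Squash (fmap (ar E) (oh f) ≈ fmap (ar E) (oh g)).
Proof.
have hf := unsquash (oh_over f); have hg := unsquash (oh_over g); apply: squash.
exact: arr_eq_trans hf (arr_eq_sym hg).
Qed.

Lemma lact_over (X : fibre E B) (Y Y' : fibre E B') (v : Hom Y Y') (f : over_hom X Y) :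
  Squash (fmap (ar E) (fh v ∘ oh f) ≈ b).
Proof.
apply: squash; rewrite fmap_cmp.
exact: arr_eq_trans (arr_eq_idl _ (fibre_identity v)) (unsquash (oh_over f)).
Qed.

Lemma ract_over (X X' : fibre E B) (Y : fibre E B') (f : over_hom X Y) (u : Hom X' X) :
  Squash (fmap (ar E) (oh f ∘ fh u) ≈ b).
Proof.
apply: squash; rewrite fmap_cmp.
exact: arr_eq_trans (arr_eq_idr _ (fibre_identity u)) (unsquash (oh_over f)).
Qed.

Lemma ptens_over (X X' : fibre E B) (Y Y' : fibre E B')
    (f : over_hom X Y) (g : over_hom X' Y') :
  Squash (fmap (ar E) (tensm (fibre_eq X X') (fibre_eq Y Y') (over_hom_sq f g)) ≈ b).
Proof.
apply: squash; exact: arr_eq_trans (tensm_ar _ _ _) (unsquash (oh_over f)).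
Qed.

(** Both sides are images under the unit functor of arrows equal to [b] up to
    identities.  This is what naturality of the unit isomorphisms over [b] needs. *)
Lemma unit_at_over_hom (X : fibre E B) (Y : fibre E B') (f : over_hom X Y) :
  fmap (ounit E) (fmap (ar E) (oh f)) ∘ unit_at X = unit_at Y ∘ fmap (ounit E) b.
Proof.
rewrite /unit_at -!fmap_cmp; congr (fmap _ _); apply: arr_eqP.
have hb := unsquash (oh_over f).
apply: arr_eq_trans (arr_eq_idr _ (is_identity_at (eqm_idm _))) _.
apply: arr_eq_trans hb (arr_eq_sym (arr_eq_idl _ _)).
exact: is_identity_at (eqm_idm _).
Qed.

Definition over_prof : MonoidalProfunctor (fibre_monoidal E B) (fibre_monoidal E B').
Proof.
unshelve refine (@Build_MonoidalProfunctor (fibre_monoidal E B) (fibre_monoidal E B')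
  over_hom (fun X Y Y' v f => OverHom (lact_over v f))
  (fun X X' Y f u => OverHom (ract_over f u)) _ _ _ _ _
  (@OverHom (funit E B) (funit E B') (fmap (ounit E) b) (ounit_arr_over E b))
  (fun X X' Y Y' f f' => @OverHom (ftens_ob X X') (ftens_ob Y Y') _ (ptens_over f f'))
  _ _ _ _ _).
- abstract (by move=> *; apply: over_hom_eq; rewrite /= cmpA).
- abstract (by move=> *; apply: over_hom_eq; rewrite /= cmp_idr).
- abstract (by move=> *; apply: over_hom_eq; rewrite /= cmpA).
- abstract (by move=> *; apply: over_hom_eq; rewrite /= cmp_idl).
- abstract (by move=> *; apply: over_hom_eq; rewrite /= cmpA).
- abstract (by move=> *; apply: over_hom_eq; rewrite /= /tensm -fmap_cmp).
- abstract (by move=> *; apply: over_hom_eq; rewrite /= /tensm -fmap_cmp).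
- abstract (move=> X X' X'' Y Y' Y'' f f' f''; apply: over_hom_eq;
    pose ff : @Hom (over_pb E E) (PbOb (fibre_eq X X')) (PbOb (fibre_eq Y Y')) :=
      @PbHom _ _ _ (PbOb (fibre_eq X X')) (PbOb (fibre_eq Y Y')) (oh f) (oh f')
        (over_hom_sq f f');
    exact: esym (nt_nat (oas E) (@PbHom _ _ _
      (PbOb (ftens_eq X X' X'')) (PbOb (ftens_eq Y Y' Y'')) ff (oh f'')
      (over_hom_sq f f'')))).
- abstract (move=> X Y f; apply: over_hom_eq; rewrite /= /flunit_arr;
    have n : oh f ∘ oul E (fo X) = oul E (fo Y) ∘
      tensm (ounit_eql (fo X)) (ounit_eql (fo Y)) (ounit_nat_sql (oh f))
      by [exact: (nt_nat (oul E) (oh f))];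
    rewrite cmpA n -!cmpA; congr (_ ∘ _); rewrite /tensm -!fmap_cmp;
    congr (fmap _ _); apply: pb_hom_eq => /=;
    [by rewrite unit_at_over_hom | by rewrite cmp_idl cmp_idr]).
- abstract (move=> X Y f; apply: over_hom_eq; rewrite /= /frunit_arr;
    have n : oh f ∘ our E (fo X) = our E (fo Y) ∘
      tensm (ounit_eqr (fo X)) (ounit_eqr (fo Y)) (ounit_nat_sqr (oh f))
      by [exact: (nt_nat (our E) (oh f))];
    rewrite cmpA n -!cmpA; congr (_ ∘ _); rewrite /tensm -!fmap_cmp;
    congr (fmap _ _); apply: pb_hom_eq => /=;
    [by rewrite cmp_idl cmp_idr | by rewrite unit_at_over_hom]).
Defined.

(** The arrow that a colimit in the total category provides lies over [b] because
    the legs of the cocone lie over identities. *)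
Lemma over_prof_continuous :
  preserves_coequalizers (fibre_incl E B) -> preserves_colimits omega (fibre_incl E B) ->
  prof_continuous over_prof.
Proof.
move=> pco pom D; split=> [J c hc l hl|x y z f g q hq s hs].
- have step n : oh (l n.+1) ∘ fmap (functor_comp (fibre_incl E B) J) (ostep n) = oh (l n).
    by have /(congr1 (@oh _ _)) := hl n.
  have [h [hh uh]] := pom _ _ hc (step_cocone (D := functor_comp (fibre_incl E B) J) step).
  (* Any leg would do, the index category being nonempty. *)
  have hb : fmap (ar E) h ≈ b.
    have e : oh (l 0) = h ∘ fh (leg c 0) by apply: esym; exact: hh 0.
    have := unsquash (oh_over (l 0)); rewrite e fmap_cmp; apply: arr_eq_trans.
    apply/arr_eq_sym/arr_eq_idr; exact: (fibre_identity (leg c 0)).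
  exists (@OverHom (apex c) D h (squash hb)); split=> [n|h' hh'].
    by apply: over_hom_eq; exact: hh n.
  apply: over_hom_eq; apply: uh => n.
  by have /(congr1 (@oh _ _)) := hh' n.
- have [_ uni] := pco _ _ _ _ _ _ hq.
  have [|h [hh uh]] := uni (fo D) (oh s).
    by have /(congr1 (@oh _ _)) := hs.
  have hb : fmap (ar E) h ≈ b.
    have e : oh s = h ∘ fh q by apply: esym; exact: hh.
    have := unsquash (oh_over s); rewrite e fmap_cmp; apply: arr_eq_trans.
    apply/arr_eq_sym/arr_eq_idr; exact: (fibre_identity q).
  exists (@OverHom z D h (squash hb)); split=> [|h' hh'].
    by apply: over_hom_eq; exact: hh.
  apply: over_hom_eq; apply: uh.
  by have /(congr1 (@oh _ _)) := hh'.
Qed.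

End FixedArrow.
End OverHom.

(** * Left overadjoints from universal arrows *)

Section UniversalArrows.
Variables (G : Category) (D E : OverCat G) (U : OverFunctor D E).

Definition universal_arrow (x : E) (d : D) (η : Hom x (U d)) : Prop :=
  is_identity (fmap (ar E) η) /\
  forall (y : D) (f : Hom x (U y)), exists! g : Hom d y, fmap U g ∘ η = f.

Hypothesis univ : forall x : E, exists (d : D) (η : Hom x (U d)), universal_arrow η.

Definition uarr (x : E) :
  {dη : {d : D & Hom x (U d)} | universal_arrow (projT2 dη)}.
Proof.
apply: constructive_indefinite_description.
by have [d [η hη]] := univ x; exists (existT _ d η).
Qed.

Definition uob (x : E) : D := projT1 (sval (uarr x)).
Definition uunit (x : E) : Hom x (U (uob x)) := projT2 (sval (uarr x)).

Lemma uunit_id (x : E) : is_identity (fmap (ar E) (uunit x)).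
Proof. exact: proj1 (svalP (uarr x)). Qed.

Definition transpose (x : E) (y : D) (f : Hom x (U y)) :
  {g : Hom (uob x) y | fmap U g ∘ uunit x = f}.
Proof.
apply: constructive_indefinite_description.
by have [g [hg _]] := proj2 (svalP (uarr x)) y f; exists g.
Qed.

Lemma uunit_epi (x : E) (y : D) (g h : Hom (uob x) y) :
  fmap U g ∘ uunit x = fmap U h ∘ uunit x -> g = h.
Proof.
move=> e; have [k [_ uk]] := proj2 (svalP (uarr x)) y (fmap U g ∘ uunit x).
by rewrite -(uk g) // -(uk h).
Qed.

Definition umap (x y : E) (f : Hom x y) : Hom (uob x) (uob y) :=
  sval (transpose (uunit y ∘ f)).

Lemma umapE (x y : E) (f : Hom x y) : fmap U (umap f) ∘ uunit x = uunit y ∘ f.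
Proof. exact: svalP (transpose _). Qed.

Definition ufunctor : Functor E D.
Proof.
exists uob umap.
- abstract (by move=> x; apply: uunit_epi; rewrite umapE fmap_id cmp_idl cmp_idr).
- abstract (by move=> x y z g f; apply: uunit_epi;
    rewrite umapE fmap_cmp -cmpA umapE !cmpA umapE).
Defined.

Lemma ufunctor_ar : functor_eq (functor_comp (ar D) ufunctor) (ar E).
Proof.
have ob x : ar D (uob x) = ar E x.
  by rewrite -(ofun_arE U) -(arr_eq_tgt (uunit_id x)).
split=> [|x y f] /=; first exact: ob.
apply: arr_eq_trans (arr_eq_sym (ofun_arM U _)) _.
apply: arr_eq_trans (arr_eq_sym (arr_eq_idr _ (uunit_id x))) _.
by rewrite -fmap_cmp umapE fmap_cmp; exact: arr_eq_idl (uunit_id y).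
Qed.

Definition ladjoint : OverFunctor E D := {| ofun := ufunctor; ofun_ar := ufunctor_ar |}.

Definition ladjoint_unit : OverNat (over_id E) (over_comp U ladjoint).
Proof.
unshelve eexists.
- exists uunit; abstract (by move=> x y f; exact: umapE).
- exact: uunit_id.
Defined.

Definition counit (y : D) : Hom (uob (U y)) y := sval (transpose (idm (U y))).

Lemma counitE (y : D) : fmap U (counit y) ∘ uunit (U y) = idm (U y).
Proof. exact: svalP (transpose _). Qed.

Definition ladjoint_counit : OverNat (over_comp ladjoint U) (over_id D).
Proof.
unshelve eexists.
- exists counit; abstract (by move=> x y f; apply: uunit_epi;
    rewrite /= !fmap_cmp -!cmpA counitE umapE cmpA counitE cmp_idl cmp_idr).
- abstract (move=> y; apply: arr_eq_trans (arr_eq_sym (ofun_arM U _)) _;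
    apply: arr_eq_trans (is_identity_inv (uunit_id (U y))
      (g := fmap (ar E) (fmap U (counit y))) _) (eq_idm (ofun_arE U _));
    by rewrite -fmap_cmp counitE fmap_id).
Defined.

Lemma universal_arrows_overadjoint : inhabited (LeftOveradjoint U).
Proof.
split; exists ladjoint ladjoint_unit ladjoint_counit.
- move=> x; apply: uunit_epi.
  by rewrite fmap_cmp -cmpA umapE cmpA counitE fmap_id.
- exact: counitE.
Qed.

End UniversalArrows.

(** * Free overmonoids *)

Section FreeOverMonoids.
Variables (G : Category) (E : MonoidalOverCat G).
Hypothesis E_liberal : liberal_over E.
Hypothesis unit_initial : forall B : G, is_initial (funit E B).
Hypothesis unit_arr_initial :
  forall (B B' : G) (b : Hom B B'), is_initial (unit_arr E b).

(** Initiality of [I(b)] provides such a square for one pair of points, and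
    initiality of [I(B)] and [I(B')] shows that it is the given pair. *)
Lemma over_hom_point (B B' : G) (b : Hom B B') (X : fibre E B) (Y : fibre E B')
    (f : over_hom b X Y) (p : Hom (funit E B) X) (q : Hom (funit E B') Y) :
  oh f ∘ fh p = fh q ∘ fmap (ounit E) b.
Proof.
have [[p' q' /= e] _] := @unit_arr_initial _ _ b (AFibreOb (oh_over f)).
by rewrite (initial_eq p p' (@unit_initial B)) (initial_eq q q' (@unit_initial B')).
Qed.

Lemma free_overmonoid (X : E) :
  exists (M : overmonoids E) (η : Hom X (forget E M)), universal_arrow (U := forget E) η.
Proof.
pose B := ar E X; pose X' : fibre_monoidal E B := @FibreOb _ E B X (squash erefl).
have [lib pco pom] := E_liberal B.
have [p _] := @unit_initial B X'.
have [F [η Funiv]] := @free_monoid (fibre_monoidal E B) X' p lib.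
exists (@Build_OverMonoid _ E B F), (fh η); split.
  exact: (@fibre_identity _ E B X' F η).
move=> C f.
have eC : ar E (om_car C) = om_base C := unsquash (fo_over (om_fob C)).
(* The arity of the carrier of [C] equals [om_base C] only propositionally,
   whence the correction of [A(f)] by an identity. *)
pose b : Hom B (om_base C) := eqm eC ∘ fmap (ar E) f.
have fb : fmap (ar E) f ≈ b.
  apply: arr_eq_sym; exact: arr_eq_idl (is_identity_at (eqm_idm eC)).
pose f' : over_hom b X' (om_fob C) := @OverHom _ _ _ _ b X' (om_fob C) f (squash fb).
have f'p : ract (m := over_prof E b) f' p = mo_one (om_mon C) ◃ punit (over_prof E b).
  by apply: over_hom_eq; exact: over_hom_point.
have [h [[h1 h2 h3] uh]] :=
  Funiv _ (over_prof E b) (om_mon C) f' (over_prof_continuous b pco pom) f'p.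
pose g : OverMonoidHom (@Build_OverMonoid _ E B F) C :=
  @OverMonHom _ _ (@Build_OverMonoid _ E B F) C b (oh h) (unsquash (oh_over h))
    (congr1 (@oh _ _ _ _ _ _ _) h2) (congr1 (@oh _ _ _ _ _ _ _) h3).
exists g; split; first exact: (congr1 (@oh _ _ _ _ _ _ _) h1).
move=> k ke.
have kb : omh_base k = b.
  apply: arr_eqP; apply: arr_eq_trans (arr_eq_sym (omh_over k)) _.
  apply: (arr_eq_trans _ fb); rewrite -ke fmap_cmp.
  exact: arr_eq_sym (arr_eq_idr _ (@fibre_identity _ E B X' F η)).
have kover : fmap (ar E) (omh_arr k) ≈ b by rewrite -kb; exact: omh_over.
have e : h = @OverHom _ _ _ _ b F (om_fob C) (omh_arr k) (squash kover).
  apply: uh; split; apply: over_hom_eq; [exact: ke | exact: (omh_mul k) |].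
  by rewrite /= -kb; exact: (omh_one k).
by apply: omh_eq; rewrite /= ?kb // e.
Qed.

Lemma forget_overadjoint : inhabited (LeftOveradjoint (forget E)).
Proof. exact: universal_arrows_overadjoint free_overmonoid. Qed.

End FreeOverMonoids.

(** * Overmonadicity *)

Section RetractMonoid.
Variables (V : MonoidalCat) (F : Monoid V) (X : V) (a : Hom F X) (s : Hom X F).
Variable m : Hom (X ⊗ X) X.
Hypothesis as_id : a ∘ s = idm X.
Hypothesis a_mul : m ∘ (a ⊠ a) = a ∘ mo_mul F.

(** The laws hold after precomposition with tensor powers of the split
    epimorphism [a], where they become those of [F]. *)
Lemma retract_assoc : m ∘ (m ⊠ idm X) = m ∘ (idm X ⊠ m) ∘ mas X X X.
Proof.
apply: (split_epi (r := (a ⊠ a) ⊠ a) (i := (s ⊠ s) ⊠ s)).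
  by rewrite !mtm_cmp as_id !mtm_id.
rewrite -!cmpA masE !mtm_cmp (reassoc (mtm_cmp _ _ _ _)) a_mul cmp_idl.
rewrite -[X in _ ⊠ X]cmp_idr -mtm_cmp cmpA a_mul -cmpA mo_assoc.
by rewrite -{2}[a]cmp_idr -mtm_cmp -!cmpA (reassoc a_mul) -!cmpA.
Qed.

Lemma retract_unitl : m ∘ ((a ∘ mo_one F) ⊠ idm X) = mlu X.
Proof.
apply: (split_epi (r := idm _ ⊠ a) (i := idm _ ⊠ s)).
  by rewrite mtm_cmp as_id cmp_idl mtm_id.
rewrite -cmpA mtm_cmp cmp_idl cmp_idr -[X in _ ⊠ X]cmp_idr -mtm_cmp cmpA a_mul.
by rewrite -cmpA mo_unitl mluE.
Qed.

Lemma retract_unitr : m ∘ (idm X ⊠ (a ∘ mo_one F)) = mru X.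
Proof.
apply: (split_epi (r := a ⊠ idm _) (i := s ⊠ idm _)).
  by rewrite mtm_cmp as_id cmp_idl mtm_id.
rewrite -cmpA mtm_cmp cmp_idl cmp_idr -[X in X ⊠ _]cmp_idr -mtm_cmp cmpA a_mul.
by rewrite -cmpA mo_unitr mruE.
Qed.

Definition retract_monoid : Monoid V :=
  {| mo_car := X; mo_mul := m; mo_one := a ∘ mo_one F;
     mo_assoc := retract_assoc; mo_unitl := retract_unitl; mo_unitr := retract_unitr |}.

End RetractMonoid.

Section OverMonoidEquality.
Variables (G : Category) (E : MonoidalOverCat G).

(** The base object is recovered as the arity of the carrier. *)
Lemma overmonoid_eq (C C' : OverMonoid E) :
  om_car C = om_car C' -> om_mul C ≈ om_mul C' -> om_one C ≈ om_one C' -> C = C'.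
Proof.
case: C => B [[X h] m e a1 a2 a3]; case: C' => B' [[X' h'] m' e' a1' a2' a3'].
rewrite /om_car /om_mul /om_one /= => eX.
have eB := unsquash h; have eB' := unsquash h'; subst B B' X'.
move=> /arr_eqP em /arr_eqP ee.
have {}em : m = m' by exact: fibre_hom_eq.
have {}ee : e = e' by exact: fibre_hom_eq.
subst m' e'.
by rewrite (proof_irrelevance _ a1 a1') (proof_irrelevance _ a2 a2')
  (proof_irrelevance _ a3 a3').
Qed.

Lemma overmonoid_arr_eq (C1 C2 C1' C2' : overmonoids E)
    (f : Hom C1 C2) (f' : Hom C1' C2') :
  C1 = C1' -> C2 = C2' -> omh_arr f ≈ omh_arr f' -> f ≈ f'.
Proof.
move=> e1 e2; subst => /arr_eqP e.
have -> : f = f'; last exact: arr_eq_refl.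
apply: omh_eq => //; apply: arr_eqP.
apply: arr_eq_trans (arr_eq_sym (omh_over f)) _; rewrite e; exact: omh_over.
Qed.

Lemma em_ob_eq (T : OverMonad E) (A A' : em_ob T) (e : em_car A = em_car A') :
  em_act A ≈ em_act A' -> A = A'.
Proof.
case: A e => x a a1 a2; case: A' => x' a' a1' a2' /= e; subst x' => /arr_eqP e.
subst a'.
by rewrite (proof_irrelevance _ a1 a1') (proof_irrelevance _ a2 a2').
Qed.

Lemma em_arr_eq (T : OverMonad E) (A1 A2 A1' A2' : em_cat T)
    (f : Hom A1 A2) (f' : Hom A1' A2') :
  A1 = A1' -> A2 = A2' -> em_arr f ≈ em_arr f' -> f ≈ f'.
Proof.
move=> e1 e2; subst => /arr_eqP e.
have -> : f = f'; last exact: arr_eq_refl.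
exact: em_hom_eq.
Qed.

End OverMonoidEquality.

Section Monadicity.
Variables (G : Category) (E : MonoidalOverCat G) (L : LeftOveradjoint (forget E)).

(** Seen in the total category, the multiplication of an overmonoid goes from
    the tensor square of its carrier, and morphisms of overmonoids over
    any arrow are compatible with it; working with this functor avoids
    comparing fibres over equal but not convertible objects. *)
Definition square : Functor E E :=
  functor_comp (otens E) (pair_functor (over_id E) (over_id E)).

Lemma omh_square (C C' : overmonoids E) (g : Hom C C') :
  omh_arr g ∘ om_mul C = om_mul C' ∘ fmap square (omh_arr g).
Proof. exact: (omh_mul g). Qed.

Notation η := (adj_unit L).
Notation ε := (adj_counit L).

Lemma unit_natural (x y : E) (f : Hom x y) : omh_arr (fmap L f) ∘ η x = η y ∘ f.
Proof. exact: (nt_nat η f). Qed.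

(** By naturality of the counit and a triangle identity, a morphism out of a
    free overmonoid is recovered from its restriction along the unit. *)
Lemma counit_eq (C : overmonoids E) (g : Hom (L (om_car C)) C) :
  omh_arr g ∘ η (om_car C) = idm (om_car C) -> g = ε C.
Proof.
move=> e; have n : g ∘ ε (L (om_car C)) = ε C ∘ fmap L (omh_arr g) :=
  nt_nat ε g.
rewrite -[LHS]cmp_idr -(adj_tri1 L) cmpA n -cmpA -fmap_cmp.
by rewrite [X in fmap L X]e fmap_id cmp_idr.
Qed.

Section Algebra.
Variable A : em_ob (induced_monad L).
Let x : E := em_car A.
Let a : Hom (om_car (L x)) x := em_act A.

Lemma alg_unit : a ∘ η x = idm x.
Proof. exact: (em_unit A). Qed.

Lemma alg_mul : a ∘ omh_arr (fmap L a) = a ∘ omh_arr (ε (L x)).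
Proof. exact: (em_mul A). Qed.

Lemma alg_base : ar E x = om_base (L x).
Proof. exact: esym (ofun_arE L x). Qed.

(** The fibre is taken over the base of [L x] rather than over the equal object
    [A(x)], so that [x] and [L x] lie in the same fibre. *)
Definition alg_fibre : fibre_monoidal E (om_base (L x)) :=
  @FibreOb _ E _ x (squash alg_base).

Lemma alg_unit_over : fmap (ar E) (η x) ≈ idm (om_base (L x)).
Proof. exact: arr_eq_trans (onat_ar η x) (eq_idm alg_base). Qed.

Lemma alg_act_over : fmap (ar E) a ≈ idm (om_base (L x)).
Proof.
have e : fmap (ar E) a ∘ fmap (ar E) (η x) = idm (ar E x).
  by rewrite -fmap_cmp alg_unit fmap_id.
apply: arr_eq_trans (is_identity_inv (onat_ar η x) e) (eq_idm _).
exact: unsquash (fo_over (om_fob (L x))).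
Qed.

Definition alg_act_fibre : Hom (om_fob (L x) : fibre_monoidal E _) alg_fibre :=
  @FibreHom _ _ _ (om_fob (L x)) alg_fibre a (squash alg_act_over).

Definition alg_unit_fibre : Hom alg_fibre (om_fob (L x) : fibre_monoidal E _) :=
  @FibreHom _ _ _ alg_fibre (om_fob (L x)) (η x) (squash alg_unit_over).

Definition alg_prod : Hom (alg_fibre ⊗ alg_fibre) alg_fibre :=
  alg_act_fibre ∘ mo_mul (om_mon (L x)) ∘ (alg_unit_fibre ⊠ alg_unit_fibre).

(** The product on [x] is computed in [L x] on generators.  That [a] respects
    products follows from the naturality of the unit, from the
    associativity law [alg_mul] of the algebra, and from the fact that
    [L a] and the counit are morphisms of overmonoids. *)
Lemma alg_prod_act :
  (a ∘ om_mul (L x) ∘ fmap square (η x)) ∘ fmap square a = a ∘ om_mul (L x).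
Proof.
have t2 : omh_arr (ε (L x)) ∘ η (om_car (L x)) = idm _ by exact: (adj_tri2 L (L x)).
rewrite -!cmpA -fmap_cmp -unit_natural fmap_cmp (reassoc (esym (omh_square _))).
rewrite -!cmpA (reassoc alg_mul) -!cmpA (reassoc (omh_square _)) -!cmpA.
by rewrite -fmap_cmp t2 fmap_id cmp_idr.
Qed.

Lemma alg_fibre_unit : alg_act_fibre ∘ alg_unit_fibre = idm alg_fibre.
Proof. by apply: fibre_hom_eq; exact: alg_unit. Qed.

Lemma alg_fibre_prod :
  alg_prod ∘ (alg_act_fibre ⊠ alg_act_fibre) = alg_act_fibre ∘ mo_mul (om_mon (L x)).
Proof. by apply: fibre_hom_eq; exact: alg_prod_act. Qed.

Definition alg_overmonoid : overmonoids E :=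
  {| om_base := om_base (L x); om_mon := retract_monoid alg_fibre_unit alg_fibre_prod |}.

Lemma alg_one : a ∘ om_one (L x) = a ∘ om_one (L x) ∘ fmap (ounit E) (idm _).
Proof. by rewrite fmap_id cmp_idr. Qed.

Definition alg_act_hom : OverMonoidHom (L x) alg_overmonoid :=
  @OverMonHom _ _ (L x) alg_overmonoid (idm (om_base (L x))) a alg_act_over
    (esym alg_prod_act) alg_one.

(** As [a] is a morphism of overmonoids extending the identity, [counit_eq]
    applies to it. *)
Lemma alg_counit : omh_arr (ε alg_overmonoid) = a.
Proof. by rewrite -(@counit_eq alg_overmonoid alg_act_hom alg_unit). Qed.

End Algebra.

Section AlgebraMorphism.
Variables (A A' : em_ob (induced_monad L)) (f : em_hom A A').
Let g : Hom (em_car A) (em_car A') := em_arr f.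

Lemma alg_hom_act : g ∘ em_act A = em_act A' ∘ omh_arr (fmap L g).
Proof. exact: (em_arr_act f). Qed.

Lemma alg_hom_mul :
  g ∘ (em_act A ∘ om_mul (L (em_car A)) ∘ fmap square (η (em_car A))) =
  em_act A' ∘ om_mul (L (em_car A')) ∘ fmap square (η (em_car A')) ∘ fmap square g.
Proof.
rewrite !cmpA alg_hom_act -!cmpA (reassoc (omh_square _)).
by rewrite -!cmpA -!fmap_cmp unit_natural.
Qed.

Lemma alg_hom_one :
  g ∘ (em_act A ∘ om_one (L (em_car A))) =
  em_act A' ∘ om_one (L (em_car A')) ∘ fmap (ounit E) (omh_base (fmap L g)).
Proof. by rewrite cmpA alg_hom_act -!cmpA omh_one. Qed.

Definition alg_hom : OverMonoidHom (alg_overmonoid A) (alg_overmonoid A') :=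
  @OverMonHom _ _ (alg_overmonoid A) (alg_overmonoid A') (omh_base (fmap L g)) g
    (arr_eq_sym (ofun_arM L g)) alg_hom_mul alg_hom_one.

End AlgebraMorphism.

Definition alg_functor : Functor (em_cat (induced_monad L)) (overmonoids E).
Proof.
exists alg_overmonoid alg_hom.
- abstract (by move=> A; apply: omh_eq => //=; rewrite fmap_id).
- abstract (by move=> A A' A'' g f; apply: omh_eq => //=; rewrite fmap_cmp).
Defined.

Lemma alg_functor_ar : functor_eq (functor_comp (ar (overmonoids E)) alg_functor)
  (ar (over_em (induced_monad L))).
Proof.
split=> [A|A A' f]; first exact: (ofun_arE L (em_car A)).
exact: (ofun_arM L (em_arr f)).
Qed.

Definition alg_overfunctor : OverFunctor (over_em (induced_monad L)) (overmonoids E) :=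
  @Build_OverFunctor _ (over_em (induced_monad L)) (overmonoids E) _ alg_functor_ar.

(** The counit at [C] is a morphism of overmonoids, so the product computed through it
    is the original one. *)
Lemma alg_comparison (C : overmonoids E) : alg_overmonoid (comparison_ob L C) = C.
Proof.
have t2 : omh_arr (ε C) ∘ η (om_car C) = idm _ by exact: (adj_tri2 L C).
apply: overmonoid_eq => //.
- have e : omh_arr (ε C) ∘ om_mul (L (om_car C)) ∘ fmap square (η (om_car C)) ≈ om_mul C.
    by rewrite omh_square -cmpA -fmap_cmp t2 fmap_id cmp_idr; exact: arr_eq_refl.
  exact: e.
- have e : omh_arr (ε C) ∘ om_one (L (om_car C)) ≈ om_one C.
    rewrite omh_one; apply: arr_eq_idr; apply: is_identity_fmap.
    exact: (onat_ar ε C).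
  exact: e.
Qed.

Lemma comparison_alg (A : em_cat (induced_monad L)) :
  comparison_ob L (alg_overmonoid A) = A.
Proof.
apply: (@em_ob_eq _ _ _ (comparison_ob L (alg_overmonoid A)) A erefl).
by rewrite /= alg_counit; exact: arr_eq_refl.
Qed.

Theorem forget_overmonadic : overmonadic L.
Proof.
exists alg_overfunctor; split; split=> /=.
- exact: alg_comparison.
- move=> C C' f; apply: overmonoid_arr_eq; [exact: alg_comparison.. | exact: arr_eq_refl].
- exact: comparison_alg.
- move=> A A' f; apply: em_arr_eq; [exact: comparison_alg.. | exact: arr_eq_refl].
Qed.

End Monadicity.

Theorem theorem4 (G : Category) (E : MonoidalOverCat G)
    (E_liberal : liberal_over E)
    (unit_initial : forall B : G, is_initial (funit E B))
    (unit_arr_initial : forall (B B' : G) (b : Hom B B'), is_initial (unit_arr E b)) :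
  exists M : LeftOveradjoint (forget E), overmonadic M.
Proof.
have [M] := forget_overadjoint E_liberal unit_initial unit_arr_initial.
by exists M; exact: forget_overmonadic.
Qed.
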